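(* Assume that $k\to\infty$ and $k=o(\sqrt m)$ as $n\to\infty$. Let $R>1$ and let $g(z)$ be a power series absolutely convergent for $|z|\le R$ with $g(z)\ne1$ for $|z|\le R$ whenever $z\neq1$, $z\in\mathbb{C}$. Also let $w(n)=o(1)$ as $n\to\infty$. Then for any $0<\epsilon'<R$ there exist functions $$q_1(n)=o(m^{-1})+O\big(R^{-k}+k^4/m^2\big)\quad\text{and}\quad q_2(n)=o(m^{-1})+O\big((R-\epsilon')^{-k}+k^4/m^2\big)$$ such that the following holds. Let $X=\{x_1,\dots,x_m\}$ be a multiset of positive integers summing to $n$, let $P_k$ and $Q_k$ be the hitting probabilities defined in the context, let $f(z)=\sum_\ell p_\ell z^\ell$ be the probability generating function of the relative frequencies $p_\ell=\frac1m\#\{j:x_j=\ell\}$, and assume that $|f(z)-g(z)|+|f'(z)-g'(z)|<w(n)$ for all $|z|\le R$. (a) (Renewal without replacement.) Provided that $|f''(1)-g''(1)|<w(n)$, $$\Big|P_k-\frac mn+\frac{g'(1)-g'(1)^2+g''(1)}{g'(1)^3\,m}\Big|\le q_1(n).$$ (b) (Renewal without replacement, size-biased.) $$\Big|Q_k-\frac mn\Big|\le q_2(n).$$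
   Context: Here $m=m(n)$ and $k=k(n)$ are positive integers depending on $n$; $q_1,q_2$ do not depend on the particular multiset $\{x_1,\dots,x_m\}$. Definition of $P_k$: let $\sigma\in\mathcal{S}_m$ be a uniformly random permutation and $S_t=\sum_{i=1}^t x_{\sigma(i)}$ for $1\le t\le m$; $P_k=\mathbb{P}(k\in\{S_1,S_2,\dots,S_m\})$. Definition of $Q_k$ (size-biased renewal process without replacement): let $\sigma(1)$ be a size-biased sample of the indices, i.e. $\mathbb{P}(\sigma(1)=j)=x_j/n$ for $j=1,\dots,m$, and given $\sigma(1)$ let $(\sigma(2),\dots,\sigma(m))$ be a uniformly random ordering of the remaining $m-1$ indices; with $S_t=\sum_{i=1}^t x_{\sigma(i)}$, $Q_k=\mathbb{P}(k\in\{S_1,\dots,S_m\})$. *)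

(* Defs.v *)
From mathcomp Require Import all_boot all_order all_algebra perm.
From mathcomp Require Import complex.
From mathcomp Require Import all_classical all_reals all_analysis.

Set Implicit Arguments.
Unset Strict Implicit.
Unset Printing Implicit Defensive.

Import Order.TTheory GRing.Theory Num.Theory.
Import numFieldNormedType.Exports.

Local Open Scope ring_scope.
Local Open Scope classical_set_scope.
Local Open Scope complex_scope.

(* Complex counterparts of pseries and pseries_diffs, to be used with         *)
(* C := R[i]. The library has no topology on R[i] under its own name; the one *)
(* used here is the topology it puts on every numClosedFieldType, whose basic *)
(* neighbourhoods are the balls of the norm of C, i.e. of the modulus.        *)

Definition cpseries (C : numClosedFieldType) (a : nat -> C) (z : C) : C^nat :=
  [series a l * z ^+ l]_l.

Definition cpsum (C : numClosedFieldType) (a : nat -> C) (z : C) : C :=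
  limn (cpseries a z).

Definition cpseries_abs_cvg (C : numClosedFieldType) (a : nat -> C) (z : C) :
    Prop :=
  cvgn [normed cpseries a z].

(* Termwise differentiation; this also gives a meaning to the derivative on   *)
(* the boundary of the closed disc where the power series is considered.      *)
Definition cpseries_diffs (C : numClosedFieldType) (a : nat -> C) : nat -> C :=
  fun l => l.+1%:R * a l.+1.

(* A multiset {x_1, ..., x_m} is given by an enumeration x : 'I_m -> nat, the *)
(* indices being shifted to 0, ..., m - 1.                                    *)

Definition partial_sum (m : nat) (x : 'I_m -> nat) (s : {perm 'I_m})
    (t : nat) : nat :=
  (\sum_(i < m | i < t) x (s i))%N.

(* k \in {S_1, ..., S_m}: t : 'I_m stands for the time t + 1. *)
Definition hits (m : nat) (x : 'I_m -> nat) (k : nat) (s : {perm 'I_m}) : bool :=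
  [exists t : 'I_m, partial_sum x s t.+1 == k].

Definition hit_prob (R : realType) (m : nat) (x : 'I_m -> nat) (k : nat) : R :=
  #|[pred s : {perm 'I_m} | hits x k s]|%:R / #|{perm 'I_m}|%:R.

(* sigma(1) = j, phrased so as to make sense for every m. *)
Definition starts_at (m : nat) (j : 'I_m) (s : {perm 'I_m}) : bool :=
  [forall i : 'I_m, (i == 0 :> nat) ==> (s i == j)].

(* sigma(1) = j has probability x_j / n, where n is the sum of the x_i, and   *)
(* given this sigma is uniform among the permutations with sigma(1) = j.      *)
Definition size_biased_hit_prob (R : realType) (m : nat) (x : 'I_m -> nat)
    (k : nat) : R :=
  \sum_(j < m) (x j)%:R / (\sum_(i < m) x i)%N%:R *
    (#|[pred s : {perm 'I_m} | starts_at j s & hits x k s]|%:R /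
     #|[pred s : {perm 'I_m} | starts_at j s]|%:R).

Definition rel_freq (R : realType) (m : nat) (x : 'I_m -> nat) (l : nat) : R :=
  #|[pred j : 'I_m | x j == l]|%:R / m%:R.

(* No x_j exceeds the sum of the x_i, so no coefficient is cut off. *)
Definition pgf (R : realType) (m : nat) (x : 'I_m -> nat) : {poly R[i]} :=
  \poly_(l < (\sum_(i < m) x i).+1) (rel_freq R x l)%:C.

(* q = o(e) + O(h) as n -> oo. *)
Definition is_oDO (R : realType) (q e h : nat -> R) : Prop :=
  exists u v : nat -> R,
    [/\ u =o_\oo e, v =O_\oo h & forall n, q n = u n + v n].

(* Main.v *)
Require Import Defs.
From mathcomp Require Import all_boot all_order all_algebra perm.
From mathcomp Require Import fingroup cyclic separable cyclotomic.
From mathcomp Require Import complex ring lra zify.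
From mathcomp Require Import all_classical all_reals all_analysis.
Set Implicit Arguments.
Unset Strict Implicit.
Unset Printing Implicit Defensive.
Import Order.TTheory GRing.Theory Num.Theory.
Import numFieldNormedType.Exports.
Import Normc.
Local Open Scope ring_scope.
Local Open Scope complex_scope.

(** Let f be the generating function of the relative frequencies, h(z) = f(z^2),
    mu = f'(1) = n/m, and let p_t be the probability that the first t steps sum
    to k. Partial sums increase, so P_k is the sum of the p_t, and since the
    first t steps are exchangeable, Q_k is m/n times the sum of (k/t) p_t
    (hit_prob_sum, size_biased_hit_prob_sum).

    Drawing without replacement is drawing with replacement conditioned on
    distinct indices. Inclusion-exclusion over colliding pairs (bonferroni,
    step_prob_estimate) gives, up to an error of order t^4/m^2,
      p_t = [z^k] (f^t + C(t,2)/m (f^2 - h) f^(t-2)).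
    The error carries as a factor the probability that some renewal process
    hits k at time t, and these probabilities sum to at most 1 over t
    (renewal_le1); the errors therefore add up to O(k^4/m^2). Summing the main
    terms (hit_prob_expansion, size_biased_hit_prob_expansion),
      P_k = [z^k] 1/(1-f) + (1/m) [z^k] (f^2 - h)/(1-f)^3 + O(k^4/m^2),
      Q_k = (m/n) [z^k] (z f'/(1-f) + k/(2m) (f^2 - h)/(1-f)^2) + O(k^4/m^2).

    At z = 1 the function 1 - f has a simple zero and f^2 - h a double one, say
    1 - f = (1-z) T and f^2 - h = (1-z)^2 W. The four quotients are then
    1/((1-z) T), W/((1-z) T^3), z f'/((1-z) T) and W/T^2. The first three have a
    simple pole at 1 and their coefficients converge to 1/mu,
    (mu^2 - mu - f''(1))/mu^3 and 1; the fourth has no pole, which is why Q_k has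
    no correction of order 1/m. The speed is exponential (quotient_coef,
    quotient_partial_sum), with rate r for the leading terms; for the terms that
    involve h it is the square root of r, and as these carry a factor 1/m, any
    rate larger than 1 is enough.

    These bounds must be uniform in the multiset, which requires a lower bound
    for T on the disc. By compactness g stays away from 1 away from z = 1
    (one_sub_cpsum_lower_bound), hence so does f when w(n) is small; close to
    z = 1, 1 - f is close to mu (1-z) with mu >= 1 and a quadratic error bounded
    through f(r) (pgf_quotient_lower_bound). All multisets that satisfy the
    hypotheses thus share the same constants (uniform_estimate). *)

(** * The modulus of complex numbers and Cauchy's estimate for polynomials *)

Section Modulus.
Variable R : realType.
Implicit Types z u v w p q : R[i].

Lemma normC_normc z : `|z| = (normc z)%:C. Proof. by []. Qed.

Lemma normc_real (x : R) : normc x%:C = `|x|.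
Proof. by rewrite /= expr0n addr0 sqrtr_sqr. Qed.

Lemma normc_ge0 z : 0 <= normc z.
Proof. by case: z => a b; exact: sqrtr_ge0. Qed.

Lemma normcX z n : normc (z ^+ n) = normc z ^+ n.
Proof. by elim: n => [|n IHn]; rewrite ?normc1 // !exprS normcM IHn. Qed.

Lemma normc_sum (I : Type) (s : seq I) (P : pred I) (F : I -> R[i]) :
  normc (\sum_(i <- s | P i) F i) <= \sum_(i <- s | P i) normc (F i).
Proof.
elim/big_ind2: _ => //; first by rewrite normc0.
by move=> a b c d ab cd; rewrite (le_trans (le_normcD _ _)) // lerD.
Qed.

Lemma normc_eq0 z : (normc z == 0) = (z == 0).
Proof. by apply/eqP/eqP => [/eq0_normc//|->]; rewrite normc0. Qed.

Lemma normc_gt0 z : (0 < normc z) = (z != 0).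
Proof. by rewrite lt0r normc_ge0 andbT normc_eq0. Qed.

Lemma le_normcB z1 z2 : normc z1 - normc z2 <= normc (z1 - z2).
Proof. by rewrite lerBlDr -{1}(subrK z2 z1) le_normcD. Qed.

Lemma normc_distC z1 z2 : normc (z1 - z2) = normc (z2 - z1).
Proof. by rewrite -normcN opprB. Qed.

Lemma normc_Re_le u : `|complex.Re u| <= normc u.
Proof. by case: u => x y /=; rewrite -sqrtr_sqr ler_sqrt ?addr_ge0 ?sqr_ge0 // lerDl sqr_ge0. Qed.

Lemma normc_Im_le u : `|complex.Im u| <= normc u.
Proof. by case: u => x y /=; rewrite -sqrtr_sqr ler_sqrt ?addr_ge0 ?sqr_ge0 // lerDr sqr_ge0. Qed.

Lemma normc_le_ReIm u : normc u <= `|complex.Re u| + `|complex.Im u|.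
Proof.
case: u => p q /=; rewrite -[leRHS]ger0_norm ?addr_ge0 // -sqrtr_sqr ler_sqrt ?sqr_ge0 //.
rewrite sqrrD !real_normK ?num_real // addrAC lerDl.
by rewrite mulrn_wge0 // mulr_ge0.
Qed.

Lemma normc_dist2 u v w : normc (u - v) <= normc (u - w) + normc (v - w).
Proof. by rewrite -(normcN (v - w)) (le_trans _ (le_normcD _ _)) // opprB addrA subrK. Qed.

Lemma normc_dist3 u v p q :
  normc (u - v) <= normc (u - p) + normc (p - q) + normc (v - q).
Proof.
rewrite (le_trans (normc_dist2 u v q)) // lerD2r.
by rewrite (normc_distC p) normc_dist2.
Qed.

Lemma normc_horner (p : {poly R[i]}) z :
  normc p.[z] <= \sum_(i < size p) normc p`_i * normc z ^+ i.
Proof.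
rewrite horner_coef (le_trans (normc_sum _ _ _)) // ler_sum // => i _.
by rewrite normcM normcX.
Qed.

Lemma primitive_root_exists n : (0 < n)%N -> exists z : R[i], n.-primitive_root z.
Proof.
move=> n_gt0; pose p : {poly R[i]} := 'X^n - 1.
have [s Dp] := closed_field_poly_normal p.
rewrite (monicP _) ?monicXnsubC // scale1r in Dp.
have sn1: all n.-unity_root s by apply/allP=> z; rewrite -root_prod_XsubC -Dp.
have sz_s: (n < (size s).+1)%N.
  by rewrite -(size_prod_XsubC s id) -Dp size_XnsubC.
have [|z _ zP] := hasP (has_prim_root n_gt0 sn1 _ sz_s); last by exists z.
by rewrite -separable_prod_XsubC -Dp separable_Xn_sub_1 // pnatr_eq0 -lt0n.
Qed.

(** Cauchy's estimate needs no integral for a polynomial p: averaging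
    p(rho w^i) w^(-ij) over the n-th roots of unity w^i, with n exceeding the
    degree, isolates the coefficient of index j exactly. *)
Lemma cauchy_coef (p : {poly R[i]}) (rho M : R) j : 0 < rho ->
  (forall z, normc z = rho -> normc p.[z] <= M) ->
  normc p`_j * rho ^+ j <= M.
Proof.
move=> rho_gt0 pM; set n := maxn (size p) j.+1.
have n_gt0 : (0 < n)%N by rewrite leq_max orbT.
have [w wP] := primitive_root_exists n_gt0.
have w0 : w != 0.
  apply/eqP => w0; have := prim_expr_order wP; rewrite w0 expr0n.
  by rewrite eqn0Ngt n_gt0 => /esym/eqP; rewrite oner_eq0.
have normw : normc w = 1.
  apply/eqP; rewrite -(@eqrXn2 _ n) ?normc_ge0 ?ler01 // expr1n -normcX.
  by rewrite (prim_expr_order wP) normc1.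
have jn : (j < n)%N by rewrite leq_max leqnn orbT.
pose W i := w ^+ i; pose S := \sum_(i < n) p.[rho%:C * W i] * (W i)^-1 ^+ j.
have SE : S = n%:R * (p`_j * rho%:C ^+ j).
  rewrite /S.
  transitivity (\sum_(i < n) \sum_(l < n) p`_l * rho%:C ^+ l * (w ^+ l / w ^+ j) ^+ i).
    apply: eq_bigr => i _; rewrite (@horner_coef_wide _ n) ?leq_maxl// mulr_suml.
    apply: eq_bigr => l _; rewrite exprMn -!mulrA; congr (_ * (_ * _)).
    by rewrite /W exprMn !exprVn -!exprM mulnC; congr (_ / w ^+ _); rewrite mulnC.
  rewrite exchange_big /= (bigD1 (Ordinal jn)) //= [X in _ + X]big1 ?addr0.
    under eq_bigr do rewrite divff ?expf_neq0 // expr1n.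
    by rewrite -mulr_sumr sumr_const card_ord mulrC.
  move=> l lj; rewrite -mulr_sumr.
  set q := w ^+ l / w ^+ j.
  have q1 : q != 1.
    rewrite -subr_eq0 -(inj_eq (mulIf (expf_neq0 j w0))) mul0r mulrBl mul1r.
    by rewrite divfK ?expf_neq0 // subr_eq0 (eq_prim_root_expr wP) !modn_small.
  have qn : q ^+ n = 1.
    by rewrite exprMn exprVn -!exprM ![(_ * n)%N]mulnC !exprM
      (prim_expr_order wP) !expr1n divr1.
  have /eqP := subrX1 q n; rewrite qn subrr eq_sym mulf_eq0 subr_eq0 (negPf q1) /=.
  by move=> /eqP ->; rewrite mulr0.
have nWE i : normc (W i) = 1 by rewrite normcX normw expr1n.
have : normc S <= n%:R * M.
  rewrite (le_trans (normc_sum _ _ _)) //.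
  rewrite -[X in X%:R]card_ord -sumr_const mulr_suml ler_sum // => i _.
  rewrite mul1r normcM normcX normcV nWE invr1 expr1n mulr1 pM // normcM nWE mulr1.
  by rewrite normc_real gtr0_norm.
rewrite SE !normcM normcX normc_real gtr0_norm // -[n%:R]/(n%:R : R[i]).
have -> : normc (n%:R : R[i]) = n%:R.
  by rewrite -(rmorph_nat (real_complex R)) normc_real normr_nat.
by rewrite ler_pM2l // ltr0n.
Qed.

End Modulus.

(** * Power series expansion of rational functions *)

Section Congruence.
Variable F : fieldType.
Implicit Types p q s : {poly F}.

(** Power series enter only through their truncations, so identities between
    them are stated as congruences of polynomials modulo 'X^n. *)
Definition eqmodX n p q := forall j, (j < n)%N -> p`_j = q`_j.

Lemma eqmodX_sym n p q : eqmodX n p q -> eqmodX n q p.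
Proof. by move=> pq j jn; rewrite pq. Qed.

Lemma eqmodX_trans n p q s : eqmodX n p q -> eqmodX n q s -> eqmodX n p s.
Proof. by move=> pq qs j jn; rewrite pq ?qs. Qed.

Lemma eqmodX_mul2l n s p q : eqmodX n p q -> eqmodX n (s * p) (s * q).
Proof.
move=> pq j jn; rewrite !coefM; apply: eq_bigr => i _.
by rewrite pq // (leq_ltn_trans (leq_subr _ _) jn).
Qed.

Lemma eqmodX_mulI n s p q : s`_0 != 0 -> eqmodX n (s * p) (s * q) -> eqmodX n p q.
Proof.
move=> s0 pq j; elim/ltn_ind: j => j IHj jn.
have := pq j jn; rewrite !coefM !big_ord_recl !subn0.
rewrite [X in _ + X](_ : _ = \sum_(i < j) s`_(lift ord0 i) * q`_(j - lift ord0 i)).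
  by move=> /addIr /(mulfI s0).
apply: eq_bigr => i _; rewrite /= /bump /= IHj //; last first.
  by rewrite (leq_ltn_trans (leq_subr _ _) jn).
by rewrite add1n ltn_subrL /= (leq_ltn_trans _ (ltn_ord i)).
Qed.

Lemma eqmodX_addXn n p s : eqmodX n (p + 'X^n * s) p.
Proof. by move=> j jn; rewrite coefD mulrC coefMXn jn addr0. Qed.

Lemma eqmodX_leq m n p q : (m <= n)%N -> eqmodX n p q -> eqmodX m p q.
Proof. by move=> mn pq j jm; rewrite pq // (leq_trans jm mn). Qed.

Lemma coef_div1subX n p q : eqmodX n ((1 - 'X) * p) q ->
  forall j, (j < n)%N -> p`_j = \sum_(i < j.+1) q`_i.
Proof.
move=> pq; elim=> [|j IHj] jn.
  by rewrite big_ord_recl big_ord0 addr0 -pq // mulrBl mul1r coefB coefXM subr0.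
rewrite big_ord_recr /= -IHj ?(ltn_trans _ jn) // -pq //.
by rewrite mulrBl mul1r coefB coefXM addrC subrK.
Qed.

End Congruence.

Section Expansion.
Variable R : realType.
Implicit Types (p q D N : {poly R[i]}) (rho sigma : R).

(** The recursion that ('X - zeta) * B = b imposes on the coefficients of a
    power series B. *)
Fixpoint div_XsubC (b : nat -> R[i]) (zeta : R[i]) (j : nat) : R[i] :=
  if j is i.+1 then (div_XsubC b zeta i - b j) / zeta else - b 0 / zeta.

Lemma div_XsubCP b zeta K : zeta != 0 ->
  ('X - zeta%:P) * \poly_(j < K.+1) div_XsubC b zeta j =
  (\poly_(j < K.+1) b j) + (div_XsubC b zeta K)%:P * 'X^(K.+1).
Proof.
move=> z0; apply/polyP => j; rewrite mulrBl coefB coefXM coefCM coefD coefCM coefXn.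
rewrite !coef_poly.
case: j => [|j] /=; first by rewrite mulr0 addr0 sub0r mulrC divfK // opprK.
rewrite !ltnS eqSS; case: (ltngtP j K) => [jK|jK|->].
- by rewrite mulr0 addr0 mulrC divfK // opprB addrC subrK.
- by rewrite !mulr0 subr0 addr0.
- by rewrite mulr0 subr0 mulr1 add0r.
Qed.

(** The quotient is expanded one linear factor at a time. As every root has
    modulus larger than sigma, each division keeps the decay sigma^(-j) of the
    coefficients, up to a constant; this decay is what makes the truncations
    converge uniformly on the smaller disc of radius rho. *)
Lemma expansion_prod (s : seq R[i]) N rho sigma :
  0 < rho -> rho < sigma -> (forall zeta, zeta \in s -> sigma < normc zeta) ->
  exists (A : nat -> R[i]) (C1 C2 : R),
  let D := \prod_(zeta <- s) ('X - zeta%:P) in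
  [/\ forall j, normc (A j) * sigma ^+ j <= C1,
      forall K, eqmodX K.+1 (D * \poly_(j < K.+1) A j) N &
      forall K z, normc z <= rho ->
        normc ((D * \poly_(j < K.+1) A j).[z] - N.[z]) <= C2 * (rho / sigma) ^+ K].
Proof.
move=> rho0 rs.
have sigma0 : 0 < sigma := lt_trans rho0 rs.
have pol_bd (p : {poly R[i]}) z : normc z <= rho ->
    normc p.[z] <= \sum_(i < size p) normc p`_i * rho ^+ i.
  move=> zr; rewrite (le_trans (normc_horner _ _)) // ler_sum // => i _.
  by rewrite ler_wpM2l ?normc_ge0 // lerXn2r // ?nnegrE ?normc_ge0 // ltW.
elim: s => [|zeta s IHs] h.
  exists (fun j => N`_j), (\sum_(i < size N) normc N`_i * sigma ^+ i),
    (\sum_(i < size N) normc N`_i * sigma ^+ i); split.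
  - move=> j; have [jN|jN] := ltnP j (size N); last first.
      rewrite nth_default // normc0 mul0r sumr_ge0 // => i _.
      by rewrite mulr_ge0 ?normc_ge0 // exprn_ge0 // ltW.
    rewrite (bigD1 (Ordinal jN)) //= lerDl sumr_ge0 // => i _.
    by rewrite mulr_ge0 ?normc_ge0 // exprn_ge0 // ltW.
  - by move=> K j jK; rewrite big_nil mul1r coef_poly jK.
  - move=> K z zr; rewrite big_nil mul1r -hornerN -hornerD.
    rewrite (le_trans (normc_horner _ _)) //.
    set q := (_ - N : {poly _}).
    have szq : (size q <= maxn K.+1 (size N))%N.
      rewrite (leq_trans (size_polyD _ _)) // size_polyN geq_max leq_maxr andbT.
      by rewrite (leq_trans (size_poly _ _)) // leq_maxl.
    have Cge0 i : 0 <= normc N`_i * sigma ^+ i.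
      by rewrite mulr_ge0 ?normc_ge0 // exprn_ge0 // ltW.
    have t0 : 0 <= rho / sigma by rewrite divr_ge0 // ltW.
    rewrite mulr_suml.
    apply: (@le_trans _ _ (\sum_(i < size q) normc N`_i * sigma ^+ i * (rho / sigma) ^+ K)).
      rewrite ler_sum // => i _; rewrite coefB coef_poly.
      case: ltnP => iK; first by rewrite subrr normc0 mul0r mulr_ge0 // exprn_ge0.
      rewrite sub0r normcN -mulrA ler_wpM2l ?normc_ge0 //.
      apply: (@le_trans _ _ (rho ^+ i)).
        by rewrite lerXn2r // ?nnegrE ?normc_ge0 // ltW.
      rewrite -{1}(divfK (lt0r_neq0 sigma0) rho) exprMn mulrC ler_wpM2l //.
        by rewrite exprn_ge0 // ltW.
      apply: ler_wiXn2l => //; last exact: ltnW.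
      by rewrite ler_pdivrMr // mul1r ltW.
    rewrite -!(big_mkord xpredT (fun i => normc N`_i * sigma ^+ i * (rho / sigma) ^+ K)).
    have [sq|sq] := leqP (size q) (size N).
      rewrite [leRHS](big_cat_nat _ sq) //= lerDl sumr_ge0 // => i _.
      by rewrite mulr_ge0 // exprn_ge0.
    rewrite (big_cat_nat _ (ltnW sq)) //= [X in _ + X]big1_seq ?addr0 // => i.
    rewrite mem_index_iota => /andP[_ /andP[Ni _]].
    by rewrite nth_default // normc0 !mul0r.
have [//|A [C1 [C2 [Abd Aeq AE]]]] := IHs.
  by move=> y ys; apply: h; rewrite inE ys orbT.
have zs : sigma < normc zeta by apply: h; rewrite inE eqxx.
have zeta0 : zeta != 0 by rewrite -normc_gt0 (lt_trans sigma0 zs).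
set B := div_XsubC A zeta; set q := \prod_(i <- s) ('X - i%:P).
have nz : 0 < normc zeta by rewrite normc_gt0.
(* C1' solves C1' * normc zeta = C1' * sigma + C1, the equality case of the
   bound that passes from B j and A j.+1 to B j.+1. *)
pose C1' := C1 / (normc zeta - sigma).
have zs0 : 0 < normc zeta - sigma by rewrite subr_gt0.
have C1_ge0 : 0 <= C1.
  by rewrite (le_trans _ (Abd 0)) // mulr_ge0 ?normc_ge0 // exprn_ge0 // ltW.
have Bbd j : normc (B j) * sigma ^+ j <= C1'.
  elim: j => [|j IHj].
    rewrite /= normcM normcN normcV expr0 mulr1 ler_pdivrMr //.
    have := Abd 0; rewrite expr0 mulr1 => /le_trans; apply.
    rewrite /C1' mulrAC ler_pdivlMr // ler_wpM2l //.
    by rewrite gerBl ltW.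
  rewrite /= normcM normcV mulrAC ler_pdivrMr //.
  have -> : C1' * normc zeta = C1' * sigma + C1.
    by rewrite /C1'; field; rewrite gt_eqF.
  rewrite (@le_trans _ _ ((normc (B j) + normc (A j.+1)) * sigma ^+ j.+1)) //.
    rewrite ler_wpM2r ?exprn_ge0 ?(ltW sigma0) //.
    by rewrite -(normcN (A j.+1)) le_normcD.
  rewrite mulrDl lerD // exprSr mulrA ler_wpM2r //.
  exact: ltW.
exists B, C1', (C2 + (\sum_(i < size q) normc q`_i * rho ^+ i) * (C1' * rho)).
rewrite big_cons -/q.
have DE K : ('X - zeta%:P) * q * \poly_(j < K.+1) B j =
    q * (\poly_(j < K.+1) A j) + 'X^(K.+1) * (q * (B K)%:P).
  by rewrite (mulrC ('X - _)) -mulrA div_XsubCP // mulrDr; congr (_ + _); ring.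
split=> // K.
  rewrite DE; apply: eqmodX_trans (Aeq K); exact: eqmodX_addXn.
move=> z zr; rewrite DE hornerD addrAC (le_trans (le_normcD _ _)) //.
rewrite mulrDl lerD ?AE //.
rewrite hornerM hornerXn hornerM hornerC !normcM normcX -mulrA mulrCA ler_pM ?normc_ge0 //.
- by rewrite mulr_ge0 ?normc_ge0 // exprn_ge0 // normc_ge0.
- exact: pol_bd.
- have -> : C1' * rho * (rho / sigma) ^+ K = C1' / sigma ^+ K * rho ^+ K.+1.
    by rewrite exprMn exprVn exprS; ring.
  rewrite mulrC ler_pM ?normc_ge0 ?exprn_ge0 ?normc_ge0 //.
    by rewrite ler_pdivlMr // exprn_gt0.
  by rewrite lerXn2r // ?nnegrE ?normc_ge0 // ltW.
Qed.

End Expansion.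

(** * Coefficients of rational functions without small poles *)

Section Quotient.
Variable R : realType.
Implicit Types (p q D N Y : {poly R[i]}) (rho M d : R).

(** Bernoulli's inequality for the square root of x, squared. The quadratic
    bound still gives k / x^k -> 0, where a linear one would not. *)
Lemma expr_ge_sqr (x : R) : 1 < x ->
  exists2 c : R, 0 < c & forall n, c * n%:R ^+ 2 <= x ^+ n.
Proof.
move=> x1; pose s := Num.sqrt x.
have s1 : 1 < s by rewrite -sqrtr1 ltr_sqrt // (lt_trans _ x1).
have sx : s ^+ 2 = x by rewrite sqr_sqrtr // ltW // (lt_trans _ x1).
exists ((s - 1) ^+ 2); first by rewrite exprn_gt0 // subr_gt0.
move=> n; rewrite -sx exprAC -exprMn lerXn2r // ?nnegrE.
- by rewrite mulr_ge0 // subr_ge0 ltW.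
- by rewrite exprn_ge0 // ltW // (lt_trans _ s1).
apply: (@le_trans _ _ (1 + (s - 1) * n%:R)); first by rewrite lerDr.
elim: n => [|n IHn]; first by rewrite mulr0 addr0.
have n0 : 0 <= n%:R :> R by [].
rewrite exprS -natr1; apply: le_trans (_ : s * (1 + (s - 1) * n%:R) <= _).
  have : 0 <= (s - 1) ^+ 2 * n%:R by rewrite mulr_ge0 // sqr_ge0.
  lra.
by rewrite ler_pM2l // (lt_trans _ s1).
Qed.

Lemma expr_small (x eps : R) : 0 <= x -> x < 1 -> 0 < eps ->
  exists K0, forall K, (K0 <= K)%N -> x ^+ K <= eps.
Proof.
rewrite le_eqVlt => /predU1P[<- _ e0|x0 x1 e0].
  by exists 1 => -[|K] // _; rewrite expr0n /= ltW.
have [|c c0 cP] := @expr_ge_sqr x^-1; first by rewrite invf_gt1.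
exists (Num.bound (c * eps)^-1).+1 => K hK.
rewrite -(invrK x) exprVn invf_ple ?posrE ?exprn_gt0 ?invr_gt0 //.
apply: le_trans (cP K); rewrite -ler_pdivrMl // -invfM.
have := archi_boundP (_ : 0 <= (c * eps)^-1).
rewrite invr_ge0 mulr_ge0 ?(ltW c0) ?(ltW e0) // => /(_ isT) /ltW h.
apply: (le_trans h); rewrite -natrX ler_nat.
by rewrite (leq_trans (leqW (leqnn _))) // (leq_trans hK) // leq_pmulr // (leq_trans _ hK).
Qed.

(** The truncations of N / D are polynomials that approach N / D uniformly on
    the circle, so that Cauchy's estimate for polynomials passes to the
    coefficients A of N / D with no loss in the constant M. *)
Lemma quotient_expansion D N rho d M : 0 < rho -> 0 < d -> 
  (forall z, normc z <= rho -> d <= normc D.[z]) ->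
  (forall z, normc z = rho -> normc N.[z] <= M * normc D.[z]) ->
  exists A : nat -> R[i],
  [/\ forall j, normc (A j) * rho ^+ j <= M,
      forall K, eqmodX K.+1 (D * \poly_(j < K.+1) A j) N &
      forall eps, 0 < eps -> exists K0, forall K, (K0 <= K)%N ->
        forall z, normc z <= rho ->
        normc ((D * \poly_(j < K.+1) A j).[z] - N.[z]) <= eps].
Proof.
move=> rho0 d0 dD NM.
have [s Ds] := closed_field_poly_normal D.
have c0 : lead_coef D != 0.
  rewrite lead_coef_eq0; apply/eqP => D0.
  have := dD 0; rewrite D0 hornerC !normc0 => /(_ (ltW rho0)).
  by rewrite leNgt d0.
have szeta zeta : zeta \in s -> rho < normc zeta.
  move=> zs; rewrite ltNge; apply/negP => /dD; rewrite Ds hornerZ.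
  have /rootP-> : root (\prod_(z <- s) ('X - z%:P)) zeta by rewrite root_prod_XsubC.
  by rewrite mulr0 normc0 leNgt d0.
have [sigma rs ss] : exists2 sigma, rho < sigma & forall zeta, zeta \in s -> sigma < normc zeta.
  elim: (s) szeta => [|y t IHt] h; first by exists (rho + 1) => //; lra.
  have [|sg rsg sgt] := IHt; first by move=> u ut; rewrite h // inE ut orbT.
  have ry : rho < normc y by rewrite h // inE eqxx.
  exists (Num.min sg ((rho + normc y) / 2)).
    by rewrite lt_min rsg /=; lra.
  move=> u; rewrite inE => /predU1P[->|ut]; rewrite gt_min.
    by apply/orP; right; lra.
  by rewrite sgt.
have [A [C1 [C2 [_ Aeq AE]]]] := @expansion_prod R s ((lead_coef D)^-1 *: N) _ _ rho0 rs ss.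
have Aeq' K : eqmodX K.+1 (D * \poly_(j < K.+1) A j) N.
  move=> j jK; rewrite Ds -scalerAl coefZ Aeq // coefZ mulrA mulfV ?mul1r //.
have AE' eps : 0 < eps -> exists K0, forall K, (K0 <= K)%N ->
    forall z, normc z <= rho -> normc ((D * \poly_(j < K.+1) A j).[z] - N.[z]) <= eps.
  move=> e0; have sg0 : 0 < sigma := lt_trans rho0 rs.
  pose C := normc (lead_coef D) * `|C2| + 1.
  have C0 : 0 < C by rewrite ltr_wpDl // mulr_ge0 // normc_ge0.
  have [|||K0 K0P] := @expr_small (rho / sigma) (eps / C).
  - by rewrite divr_ge0 // ltW.
  - by rewrite ltr_pdivrMr // mul1r.
  - by rewrite divr_gt0.
  exists K0 => K KK z zr.
  have -> : (D * \poly_(j < K.+1) A j).[z] - N.[z] = lead_coef D *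
      (((\prod_(zeta <- s) ('X - zeta%:P)) * \poly_(j < K.+1) A j).[z] -
       ((lead_coef D)^-1 *: N).[z]).
    rewrite {1}Ds -scalerAl !hornerZ mulrBr; congr (_ - _).
    by rewrite mulrA mulfV // mul1r.
  rewrite normcM (le_trans (ler_wpM2l (normc_ge0 _) (AE K z zr))) //.
  have t0 : 0 <= (rho / sigma) ^+ K by rewrite exprn_ge0 // divr_ge0 // ltW.
  apply: (@le_trans _ _ (C * (rho / sigma) ^+ K)).
    rewrite mulrA ler_wpM2r // (le_trans (ler_wpM2l (normc_ge0 _) (ler_norm C2))) //.
    by rewrite lerDl.
  by rewrite mulrC -ler_pdivlMr // K0P.
exists A; split=> // j.
apply/ler_addgt0Pr => eps e0.
have [|K0 K0P] := AE' (eps * d); first by rewrite mulr_gt0.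
pose K := maxn j K0.
have -> : A j = (\poly_(i < K.+1) A i)`_j by rewrite coef_poly ltnS leq_maxl.
apply: cauchy_coef => // z zr.
have Dz : 0 < normc D.[z] by rewrite (lt_le_trans d0) // dD // zr.
rewrite -(ler_pM2l Dz) -normcM -hornerM.
rewrite -(subrK N.[z] (D * _).[z]) (le_trans (le_normcD _ _)) //.
rewrite mulrDr addrC lerD //; first by rewrite mulrC NM.
rewrite (le_trans (K0P K _ z _)) ?leq_maxr ?zr // mulrC ler_pM2r //.
by rewrite dD // zr.
Qed.

(** The conclusion speaks of any polynomial Y that agrees with N / D up to
    degree k. A truncated sum of powers of a generating function is such a Y. *)
Lemma quotient_coef D N Y rho d M k : 0 < rho -> 0 < d -> 
  (forall z, normc z <= rho -> d <= normc D.[z]) ->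
  (forall z, normc z = rho -> normc N.[z] <= M * normc D.[z]) ->
  eqmodX k.+1 (D * Y) N -> normc Y`_k <= M / rho ^+ k.
Proof.
move=> rho0 d0 dD NM YN.
have [A [Abd Aeq _]] := quotient_expansion rho0 d0 dD NM.
have D0 : D`_0 != 0.
  by rewrite -horner_coef0 -normc_gt0 (lt_le_trans d0) // dD // normc0 ltW.
have YA := eqmodX_mulI D0 (eqmodX_trans YN (eqmodX_sym (Aeq k))).
by rewrite YA // coef_poly ltnSn ler_pdivlMr ?exprn_gt0.
Qed.

Lemma geometric_tail rho k K : 1 < rho -> (k <= K)%N ->
  \sum_(k <= j < K) (rho ^+ j.+1)^-1 <= (rho ^+ k)^-1 / (rho - 1).
Proof.
move=> rho1 kK; have rho0 : 0 < rho := lt_trans ltr01 rho1.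
suff -> : \sum_(k <= j < K) (rho ^+ j.+1)^-1 =
    ((rho ^+ k)^-1 - (rho ^+ K)^-1) / (rho - 1).
  by rewrite ler_pM2r ?invr_gt0 ?subr_gt0 // gerBl invr_ge0 exprn_ge0 // ltW.
rewrite -(subnKC kK); elim: (K - k)%N => [|i IHi].
  by rewrite addn0 big_geq // subrr mul0r.
rewrite addnS big_nat_recr /= ?leq_addr // IHi exprS.
have : rho ^+ (k + i) != 0 by rewrite expf_neq0 // gt_eqF.
have : rho ^+ k != 0 by rewrite expf_neq0 // gt_eqF.
set u := rho ^+ (k + i); set v := rho ^+ k => u0 v0; field.
by rewrite u0 v0 !gt_eqF // ?subr_gt0.
Qed.

(** Singularity analysis at a simple pole: the coefficient of index k of
    N / ((1 - z) D) is a partial sum of the coefficients of N / D, hence the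
    value of N / D at 1 up to a tail of Cauchy estimates. *)
Lemma quotient_partial_sum D N Y rho d M k : 1 < rho -> 0 < d -> 
  (forall z, normc z <= rho -> d <= normc D.[z]) ->
  (forall z, normc z = rho -> normc N.[z] <= M * normc D.[z]) ->
  eqmodX k.+1 ((1 - 'X) * D * Y) N ->
  normc (Y`_k - N.[1] / D.[1]) <= M / (rho - 1) / rho ^+ k.
Proof.
move=> rho1 d0 dD NM YN; have rho0 : 0 < rho := lt_trans ltr01 rho1.
have [A [Abd Aeq AE]] := quotient_expansion rho0 d0 dD NM.
have D0 : D`_0 != 0.
  by rewrite -horner_coef0 -normc_gt0 (lt_le_trans d0) // dD // normc0 ltW.
rewrite (mulrC (1 - 'X)) -mulrA in YN.
have YA := eqmodX_mulI D0 (eqmodX_trans YN (eqmodX_sym (Aeq k))).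
have Yk : Y`_k = \sum_(i < k.+1) A i.
  rewrite (coef_div1subX YA) //; apply: eq_bigr => i _.
  by rewrite coef_poly ltn_ord.
have BE K : (\poly_(j < K.+1) A j).[1] = \sum_(i < K.+1) A i.
  rewrite horner_poly; by under eq_bigr do rewrite expr1n mulr1.
have n1 : normc 1 <= rho by rewrite normc1 ltW.
apply/ler_addgt0Pr => eps e0.
have [|K0 K0P] := AE (eps * d); first by rewrite mulr_gt0.
pose K := maxn k K0.
have D1 := dD _ n1.
have D1gt0 : 0 < normc D.[1] := lt_le_trans d0 D1.
have h1 : normc (\sum_(i < K.+1) A i - N.[1] / D.[1]) <= eps.
  rewrite -(ler_pM2r D1gt0) -normcM mulrBl divfK -?normc_gt0 //.
  rewrite mulrC -BE -hornerM (le_trans (K0P _ _ _ n1)) ?leq_maxr //.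
  by rewrite ler_pM2l.
have h2 : normc (Y`_k - \sum_(i < K.+1) A i) <= M / (rho - 1) / rho ^+ k.
  rewrite Yk -!(big_mkord xpredT A).
  rewrite (@big_cat_nat _ _ _ k.+1 0 K.+1) //= ?ltnS ?leq_maxl //.
  rewrite opprD addNKr normcN (le_trans (normc_sum _ _ _)) //.
  have M0 : 0 <= M by rewrite (le_trans _ (Abd 0)) // mulr_ge0 ?normc_ge0.
  rewrite big_add1 /=.
  apply: (@le_trans _ _ (\sum_(k <= i < K) M * (rho ^+ i.+1)^-1)).
    by apply: ler_sum => i _; rewrite ler_pdivlMr ?exprn_gt0.
  rewrite -mulr_sumr -mulrA ler_wpM2l // mulrC geometric_tail // leq_maxl //.
rewrite -(subrK (\sum_(i < K.+1) A i) Y`_k) -addrA (le_trans (le_normcD _ _)) //.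
by rewrite lerD.
Qed.

End Quotient.

(** * Uniformly random permutations *)

Section Permutations.
Variables (R : realType) (m' : nat).
Local Notation m := m'.+1.
Variable x : 'I_m -> nat.
Implicit Types (s : {perm 'I_m}) (i t k : nat).

Definition visits t k : nat := #|[pred s : {perm 'I_m} | partial_sum x s t == k]|.

Definition step_prob t k : R := (visits t k)%:R / (m`!)%:R.

Lemma partial_sum_tperm a b s t : ((a : 'I_m) < t)%N = ((b : 'I_m) < t)%N ->
  partial_sum x (tperm a b * s) t = partial_sum x s t.
Proof.
move=> ab; rewrite /partial_sum (reindex_inj (@perm_inj _ (tperm a b))).
by apply: eq_big => [i|i _]; [case: tpermP => // -> | rewrite permM tpermK].
Qed.

Lemma partial_sumS s t (tm : (t < m)%N) :
  partial_sum x s t.+1 = (partial_sum x s t + x (s (Ordinal tm)))%N.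
Proof.
rewrite /partial_sum (bigD1 (Ordinal tm)) //= addnC; congr (_ + _)%N.
by apply: eq_bigl => i; rewrite -val_eqE /= ltnS (ltn_neqAle i t) andbC.
Qed.

Lemma partial_sum0 s : partial_sum x s 0 = 0%N.
Proof. by rewrite /partial_sum big_pred0. Qed.

(** The weight i of the first step records a collision: for i, t > 0 the index
    drawn first is counted with multiplicity i + 1. *)
Definition visit_gf i t : {poly R} :=
  \sum_(s : {perm 'I_m}) 'X^(partial_sum x s t + i * x (s ord0)).

Definition power_gf i : {poly R} := \sum_(j < m) 'X^(i * x j).

Lemma card_ltn_ord t : (t <= m)%N -> #|(fun l : 'I_m => (l < t)%N)| = t.
Proof.
by move=> tm; rewrite -[RHS]card_ord -!sum1_card (big_ord_widen m (fun=> 1%N)).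
Qed.

(** The index j of the extra factor 'X^(i.+1 * x j) is s l for a unique position
    l. If l < t, the index was already drawn, and by symmetry it may be taken
    to be the first one drawn; if t <= l, it is a new index, and by symmetry it
    is the one drawn at time t. *)
Lemma visit_gf_rec i t : (t < m)%N ->
  power_gf i.+1 * visit_gf 0 t = visit_gf i.+1 t *+ t + visit_gf i t.+1 *+ (m - t).
Proof.
move=> tm; pose F (l : 'I_m) : {poly R} :=
  \sum_(s : {perm 'I_m}) 'X^(partial_sum x s t + i.+1 * x (s l)).
have Flt (l : 'I_m) : (l < t)%N -> F l = visit_gf i.+1 t.
  move=> lt; rewrite /F (reindex_inj (mulgI (tperm ord0 l))).
  apply: eq_bigr => s _; rewrite partial_sum_tperm ?lt ?(leq_trans _ lt) //.
  by rewrite permM tpermR.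
have Fge (l : 'I_m) : (t <= l)%N -> F l = visit_gf i t.+1.
  move=> tl; rewrite /F (reindex_inj (mulgI (tperm (Ordinal tm) l))).
  rewrite [RHS](reindex_inj (mulgI (tperm ord0 (Ordinal tm)))).
  apply: eq_bigr => s _; rewrite !partial_sum_tperm //= ?ltnn ?ltnSn //; last first.
    by rewrite ltnNge tl.
  by rewrite !permM tpermR tpermL partial_sumS mulSn addnA.
transitivity (\sum_(l < m) F l).
  rewrite /F exchange_big /= mulr_sumr; apply: eq_bigr => s _.
  rewrite mulr_suml [LHS](reindex_inj (@perm_inj _ s)).
  by apply: eq_bigr => l _; rewrite mul0n addn0 -exprD addnC.
rewrite (bigID (fun l : 'I_m => (l < t)%N)) /=; congr (_ + _).
  rewrite (eq_bigr (fun=> visit_gf i.+1 t)); last exact: Flt.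
  by rewrite sumr_const card_ltn_ord // ltnW.
rewrite (eq_bigr (fun=> visit_gf i t.+1)); last by move=> l; rewrite -leqNgt => /Fge.
rewrite sumr_const; congr (_ *+ _).
have := cardC (fun l : 'I_m => (l < t)%N); rewrite card_ord.
rewrite card_ltn_ord ?(ltnW tm) // => E; apply: (@addnI t); rewrite subnKC ?(ltnW tm) //.
Qed.

Lemma coef_visit_gf t k : (visit_gf 0 t)`_k = (visits t k)%:R.
Proof.
rewrite /visit_gf /visits coef_sum -sum1_card natr_sum [RHS]big_mkcond /=.
by apply: eq_bigr => s _; rewrite mul0n addn0 coefXn inE eq_sym; case: eqP.
Qed.

(** Given that the first t steps sum to k, each of them has mean k / t, since
    they are exchangeable. *)
Lemma size_biased_visits t k : (0 < t <= m)%N ->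
  (t * \sum_(s | partial_sum x s t == k) x (s ord0) = k * visits t k)%N.
Proof.
move=> /andP[t0 tm].
have E (l : 'I_m) : (l < t)%N -> (\sum_(s | partial_sum x s t == k) x (s l) =
    \sum_(s | partial_sum x s t == k) x (s ord0))%N.
  move=> lt; rewrite (reindex_inj (mulgI (tperm ord0 l))).
  by apply: eq_big => s; rewrite ?partial_sum_tperm ?lt ?t0 // permM tpermR.
transitivity (\sum_(l < m | l < t) \sum_(s | partial_sum x s t == k) x (s l))%N.
  rewrite (eq_bigr _ E) sum_nat_const; congr (_ * _)%N.
  by rewrite card_ltn_ord.
rewrite exchange_big /= /visits -sum1_card big_distrr /=.
by apply: eq_big => s // /eqP; rewrite /partial_sum muln1.
Qed.

Hypothesis x_gt0 : forall j, (0 < x j)%N.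

Lemma partial_sum_ltS s t : (t < m)%N -> (partial_sum x s t < partial_sum x s t.+1)%N.
Proof. by move=> tm; rewrite (partial_sumS s tm) -addn1 leq_add2l. Qed.

Lemma partial_sum_lt s t t' : (t < t' <= m)%N -> (partial_sum x s t < partial_sum x s t')%N.
Proof.
case/andP; elim: t' => // t' IHt'; rewrite ltnS leq_eqVlt => /predU1P[->|tt'] t'm.
  exact: partial_sum_ltS.
by rewrite (ltn_trans (IHt' tt' (ltnW t'm))) // partial_sum_ltS.
Qed.

Lemma partial_sum_ge s t : (t <= m)%N -> (t <= partial_sum x s t)%N.
Proof.
elim: t => // t IHt tm; rewrite (leq_ltn_trans (IHt (ltnW tm))) //.
exact: partial_sum_ltS.
Qed.

Lemma visits_eq0 t k : (k < t <= m)%N -> visits t k = 0%N.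
Proof.
case/andP => kt tm; apply: eq_card0 => s; rewrite !inE; apply/negbTE.
by rewrite gtn_eqF // (leq_trans kt) // partial_sum_ge.
Qed.

(** Partial sums increase strictly, so k is hit at most once. *)
Lemma hitsE k s : hits x k s = (\sum_(t < m) (partial_sum x s t.+1 == k))%N :> nat.
Proof.
rewrite /hits; case: existsP => [[t tk]|h].
  rewrite (bigD1 t) //= tk big1 // => t' t't; move/eqP: tk => <-.
  case: (ltngtP t' t) => [lt|lt|/val_inj e]; last by rewrite e eqxx in t't.
    by rewrite ltn_eqF // partial_sum_lt // ltnS lt ltn_ord.
  by rewrite gtn_eqF // partial_sum_lt // ltnS lt ltn_ord.
by rewrite big1 // => t _; apply/eqP; rewrite eqb0; apply/negP => e; apply: h; exists t.
Qed.

Lemma card_perm_ord : #|{perm 'I_m}| = m`!.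
Proof.
have := card_perm [set: 'I_m]; rewrite cardsT card_ord => <-.
by apply: eq_card => s; rewrite !inE /perm_on; apply/esym/fintype.subsetP => i; rewrite inE.
Qed.

Lemma sum_hits (F : {perm 'I_m} -> R) k : 
  \sum_(s | hits x k s) F s = \sum_(t < m) \sum_(s | partial_sum x s t.+1 == k) F s.
Proof.
under [RHS]eq_bigr do rewrite big_mkcond.
rewrite exchange_big big_mkcond /=; apply: eq_bigr => s _.
transitivity (F s *+ hits x k s); first by case: hits; rewrite ?mulr1n.
rewrite hitsE -mulr_natr natr_sum mulr_sumr; apply: eq_bigr => t _.
by case: eqP; rewrite ?mulr1 ?mulr0.
Qed.

Lemma hit_prob_sum k : (k <= m)%N ->
  hit_prob R x k = \sum_(t < k) step_prob t.+1 k.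
Proof.
move=> km; rewrite /hit_prob card_perm_ord -sum1_card natr_sum.
under eq_bigl do rewrite inE.
rewrite sum_hits mulr_suml (big_ord_widen m (fun t => step_prob t.+1 k)) // big_mkcond.
rewrite [RHS]big_mkcond /=; apply: eq_bigr => t _.
rewrite -natr_sum sum1_card; case: ltnP => // kt.
by rewrite -/(visits _ _) visits_eq0 ?mul0r // ltnS kt ltn_ord.
Qed.

Lemma starts_atE j s : starts_at j s = (s ord0 == j).
Proof.
apply/forallP/eqP => [/(_ ord0) /implyP/(_ isT)/eqP //|sj i].
by apply/implyP => /eqP i0; rewrite -sj; apply/eqP; congr (s _); apply: val_inj.
Qed.

Lemma card_starts_at j : #|[pred s : {perm 'I_m} | starts_at j s]| = m'`!.
Proof.
have C l : #|[pred s : {perm 'I_m} | starts_at l s]| = #|[pred s : {perm 'I_m} | starts_at j s]|.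
  rewrite -!sum1_card (reindex_inj (mulIg (tperm j l))) /=.
  by apply: eq_bigl => s; rewrite !inE !starts_atE permM (canF_eq (tpermK j l)) tpermR.
apply/eqP; rewrite -(eqn_pmul2l (ltn0Sn m')) -factS -card_perm_ord.
rewrite -{1}(card_ord m) -sum_nat_const -(eq_bigr _ (fun l _ => C l)).
apply/eqP; under eq_bigr do rewrite -sum1_card.
rewrite (exchange_big_dep xpredT) //= -sum1_card; apply: eq_bigr => s _.
rewrite (bigD1 (s ord0)) /=; last by rewrite inE starts_atE.
rewrite big1 ?addn0 // => l /andP[]; rewrite !inE starts_atE => /eqP ->; by rewrite eqxx.
Qed.

(** Biasing the first step by its size weights the event that k is hit at time
    t by the first step; by exchangeability this weight averages to k / t. *)
Lemma size_biased_hit_prob_sum n k : (k <= m)%N -> (\sum_(j < m) x j)%N = n ->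
  size_biased_hit_prob R x k =
  m%:R / n%:R * \sum_(t < k) k%:R / t.+1%:R * step_prob t.+1 k.
Proof.
move=> km xn; rewrite /size_biased_hit_prob xn.
transitivity (\sum_(s | hits x k s) ((x (s ord0))%:R / n%:R / (m'`!)%:R : R)).
  rewrite (partition_big (fun s : {perm 'I_m} => s ord0) xpredT) //=.
  apply: eq_bigr => j _; rewrite card_starts_at.
  rewrite (eq_bigr (fun=> (x j)%:R / n%:R / (m'`!)%:R)); last by move=> s /andP[_ /eqP->].
  rewrite sumr_const -[RHS]mulr_natr [RHS]mulrAC -[RHS]mulrA; congr (_ * (_%:R / _)).
  by apply: eq_card => s; rewrite !inE starts_atE andbC.
rewrite sum_hits mulr_sumr.
rewrite (big_ord_widen m (fun t => m%:R / n%:R * (k%:R / t.+1%:R * step_prob t.+1 k))) //.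
rewrite [RHS]big_mkcond /=; apply: eq_bigr => t _.
rewrite -!mulr_suml -natr_sum.
have tm : (0 < t.+1 <= m)%N by rewrite ltn_ord.
have := size_biased_visits k tm.
case: ltnP => kt.
  move=> /(congr1 (fun a => a%:R : R)); rewrite !natrM /step_prob factS natrM => h.
  have f0 : (m'`!)%:R != 0 :> R by rewrite pnatr_eq0 -lt0n fact_gt0.
  have m0 : m%:R != 0 :> R by rewrite pnatr_eq0.
  have t0 : t.+1%:R != 0 :> R by rewrite pnatr_eq0.
  rewrite (canRL (mulfK t0) (etrans (mulrC _ _) h)).
  move: f0 m0 t0; move: (m'`!)%:R m%:R t.+1%:R n%:R^-1 k%:R (visits _ _)%:R.
  by move=> *; field; apply/and3P; split.
rewrite visits_eq0 ?ltnS ?kt ?ltn_ord // muln0 => /eqP; rewrite muln_eq0 /= => /eqP ->.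
by rewrite !mul0r.
Qed.

(** The probability that t indices drawn with replacement are distinct. *)
Definition falling t : R := \prod_(i < t) (1 - i%:R / m%:R).

(** For i = 0, the generating function of the sum of t steps drawn with
    replacement, restricted to the event that the indices are distinct. *)
Definition distinct_gf i t : {poly R} := (falling t / (m`!)%:R) *: visit_gf i t.

Lemma falling_gt0 t : (t <= m)%N -> 0 < falling t.
Proof.
move=> tm; apply: prodr_gt0 => i _; rewrite subr_gt0 ltr_pdivrMr ?ltr0n // mul1r ltr_nat.
by rewrite (leq_trans (ltn_ord i)).
Qed.

Lemma distinct_gf_rec i t : (t < m)%N ->
  distinct_gf i t.+1 =
  (m%:R^-1 *: power_gf i.+1) * distinct_gf 0 t - (t%:R / m%:R) *: distinct_gf i.+1 t.
Proof.
move=> tm; have m0 : m%:R != 0 :> R by rewrite pnatr_eq0.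
have f0 : (m`!)%:R != 0 :> R by rewrite pnatr_eq0 -lt0n fact_gt0.
have fallS : falling t.+1 = falling t * ((m - t)%:R / m%:R).
  by rewrite /falling big_ord_recr /= natrB ?(ltnW tm) // mulrBl divff.
have scaleM (a b : R) (p q : {poly R}) : (a *: p) * (b *: q) = (a * b) *: (p * q).
  by rewrite -scalerAr -scalerAl scalerA mulrC.
rewrite /distinct_gf fallS scaleM visit_gf_rec //.
move: f0 m0; move: (m`!)%:R m%:R => f M f0 M0.
rewrite scalerDr -!scalerMnr (scalerMnl _ (visit_gf i.+1 t)) (scalerMnl _ (visit_gf i t.+1)).
rewrite scalerA addrAC.
rewrite (_ : M^-1 * (falling t / f) *+ t = t%:R / M * (falling t / f)); last first.
  by rewrite -[LHS]mulr_natr; ring.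
rewrite subrr add0r; congr (_ *: _); rewrite -[RHS]mulr_natr.
by move: (falling t) ((m - t)%:R : R) => u v; ring.
Qed.

Lemma coef_distinct_gf t k : (distinct_gf 0 t)`_k = falling t * step_prob t k.
Proof. by rewrite coefZ coef_visit_gf mulrAC -mulrA. Qed.

Lemma distinct_gf0 : distinct_gf 0 0 = 1.
Proof.
rewrite /distinct_gf /falling big_ord0 /visit_gf.
rewrite (eq_bigr (fun=> 1)); last by move=> s _; rewrite partial_sum0.
rewrite sumr_const (eq_card (B := {perm 'I_m})) // card_perm_ord -scalerMnr (scalerMnl _ 1) mul1r.
by rewrite -mulr_natr mulVf ?scale1r // pnatr_eq0 -lt0n fact_gt0.
Qed.

Lemma distinct_gf_ge0 i t k : (t <= m)%N -> 0 <= (distinct_gf i t)`_k.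
Proof.
move=> tm; rewrite coefZ mulr_ge0 ?divr_ge0 ?(ltW (falling_gt0 _)) //.
by rewrite coef_sum sumr_ge0 // => s _; rewrite coefXn.
Qed.

End Permutations.

(** * Inclusion-exclusion for distinct steps, and renewal probabilities *)

Section DistinctSteps.
Variable R : realType.
Implicit Types (f h p q : {poly R}) (t d k K : nat).
Local Notation nneg := (polyOver (@Num.Def.nneg_num_pred R)).

Lemma nneg_coef p k : p \is a nneg -> 0 <= p`_k.
Proof. by move=> /polyOverP/(_ k). Qed.

Lemma nneg_coefB p q k : q - p \is a nneg -> p`_k <= q`_k.
Proof. by move=> /(nneg_coef k); rewrite coefB subr_ge0. Qed.

Lemma nneg_partial_sum_le p K : p \is a nneg -> \sum_(i < K) p`_i <= p.[1].
Proof.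
move=> pn; rewrite horner_coef; under [leRHS]eq_bigr do rewrite expr1n mulr1.
rewrite -!(big_mkord xpredT (fun i => p`_i)).
have [sK|sK] := leqP K (size p).
  by rewrite [leRHS](big_cat_nat _ sK) //= lerDl sumr_ge0 // => i _; apply: nneg_coef.
rewrite (big_cat_nat _ (ltnW sK)) //= [X in _ + X]big1_seq ?addr0 // => i.
by rewrite mem_index_iota => /andP[_ /andP[pi _]]; rewrite nth_default.
Qed.

Lemma coef_natM (n : nat) p k : (n%:R * p)`_k = n%:R * p`_k.
Proof. by rewrite !mulr_natl coefMn. Qed.

(** The terms of the expansion of 1 / (1 - f)^(d+1) in powers of f. *)
Definition binpow f d t : {poly R} := 'C(t, d)%:R * f ^+ (t - d).

Lemma binpow0 f t : binpow f 0 t = f ^+ t.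
Proof. by rewrite /binpow bin0 mul1r subn0. Qed.

Lemma binpowS f d t : binpow f d.+1 t.+1 = f * binpow f d.+1 t + binpow f d t.
Proof.
rewrite /binpow subSS binS natrD mulrDl; congr (_ + _).
have [dt|td] := ltnP d t; last by rewrite bin_small ?ltnS // !mul0r mulr0.
by rewrite mulrCA -exprS; congr (_ * _ ^+ _); lia.
Qed.

Lemma binpow_time0 f d : binpow f d.+1 0 = 0.
Proof. by rewrite /binpow bin_small // mul0r. Qed.

Lemma mul_binpow f d t : t.+1%:R * binpow f d t = d.+1%:R * binpow f d.+1 t.+1.
Proof. by rewrite /binpow subSS !mulrA -!natrM mul_bin_diag. Qed.

Lemma binpow1S f t : binpow f 1 t.+1 = t.+1%:R * f ^+ t.
Proof. by rewrite -binpow0 mul_binpow mul1r. Qed.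

(** Let b0 t be the restriction of f^t to distinct indices. The first
    two terms of inclusion-exclusion over colliding pairs bound b0 t from below;
    adding the terms with two colliding pairs, which are disjoint (h^2) or share
    an index (e), bounds it from above. Instead of counting pairs, the proof
    unrolls the recursion of distinct_gf_rec: the binomial coefficients
    appear through Pascal's rule. *)
Lemma bonferroni m (c f h e : {poly R}) (b0 b1 b2 b3 : nat -> {poly R}) :
  c \is a nneg -> f \is a nneg -> h \is a nneg -> e \is a nneg ->
  (forall t, (t <= m)%N -> [/\ b0 t \is a nneg, b1 t \is a nneg, b2 t \is a nneg
                            & b3 t \is a nneg]) ->
  b0 0 = 1 ->
  (forall t, (t < m)%N -> [/\ b0 t.+1 = f * b0 t - t%:R * c * b1 t,
     b1 t.+1 = h * b0 t - t%:R * c * b2 t & b2 t.+1 = e * b0 t - t%:R * c * b3 t]) ->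
  forall t, (t <= m)%N ->
  b0 t - (binpow f 0 t - c * h * binpow f 2 t) \is a nneg /\
  binpow f 0 t - c * h * binpow f 2 t +
    c ^+ 2 * (3 * (h ^+ 2 * binpow f 4 t) + 2 * (e * binpow f 3 t)) - b0 t \is a nneg.
Proof.
move=> cn fn hn en bn b00 brec.
have U t : (t <= m)%N -> f ^+ t - b0 t \is a nneg.
  elim: t => [|t IHt] tm; first by rewrite b00 expr0 subrr rpred0.
  have [-> _ _] := brec t tm; have [_ b1n _ _] := bn t (ltnW tm).
  rewrite (_ : _ - _ = f * (f ^+ t - b0 t) + t%:R * c * b1 t); last by rewrite exprS; ring.
  by rewrite rpredD ?rpredM ?IHt ?rpred_nat // ltnW.
have U1 t : (t <= m)%N -> h * binpow f 1 t - t%:R * b1 t \is a nneg.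
  case: t => [|t] tm; first by rewrite binpow_time0 mul0r mulr0 subrr rpred0.
  have [_ -> _] := brec t tm; have [_ _ b2n _] := bn t (ltnW tm).
  rewrite binpow1S.
  rewrite (_ : _ - _ = t.+1%:R * (h * (f ^+ t - b0 t) + t%:R * c * b2 t)); last by ring.
  by rewrite rpredM ?rpredD ?rpredM ?U ?rpred_nat // ltnW.
have U2 t : (t <= m)%N -> e * binpow f 1 t - t%:R * b2 t \is a nneg.
  case: t => [|t] tm; first by rewrite binpow_time0 mul0r mulr0 subrr rpred0.
  have [_ _ ->] := brec t tm; have [_ _ _ b3n] := bn t (ltnW tm).
  rewrite binpow1S.
  rewrite (_ : _ - _ = t.+1%:R * (e * (f ^+ t - b0 t) + t%:R * c * b3 t)); last by ring.
  by rewrite rpredM ?rpredD ?rpredM ?U ?rpred_nat // ltnW.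
have L t : (t <= m)%N -> b0 t - (binpow f 0 t - c * h * binpow f 2 t) \is a nneg.
  elim: t => [|t IHt] tm.
    by rewrite b00 binpow0 binpow_time0 mulr0 subr0 expr0 subrr rpred0.
  have [-> _ _] := brec t tm; rewrite binpowS binpow0 exprS -binpow0.
  rewrite (_ : _ - _ = f * (b0 t - (binpow f 0 t - c * h * binpow f 2 t)) +
                       c * (h * binpow f 1 t - t%:R * b1 t)); last by ring.
  by rewrite rpredD ?rpredM ?IHt ?U1 // ltnW.
move=> t tm; split; first exact: L.
have L1 t' : (t' <= m)%N ->
    t'%:R * b1 t' - h * binpow f 1 t' +
      c * (3 * (h ^+ 2 * binpow f 3 t') + 2 * (e * binpow f 2 t')) \is a nneg.
  case: t' => [|t'] t'm.
    by rewrite !binpow_time0 !mul0r !(mulr0, addr0, subr0) rpred0.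
  have [_ -> _] := brec t' t'm.
  rewrite (_ : _ + _ = t'.+1%:R * h * (b0 t' - (binpow f 0 t' - c * h * binpow f 2 t')) +
     t'.+1%:R * c * (e * binpow f 1 t' - t'%:R * b2 t')); last first.
    have E1 := mul_binpow f 0 t'; have E2 := mul_binpow f 1 t'; have E3 := mul_binpow f 2 t'.
    rewrite mul1r in E1; rewrite -E1.
    transitivity (t'.+1%:R * (h * b0 t' - t'%:R * c * b2 t') - h * (t'.+1%:R * binpow f 0 t')
      + c * (h ^+ 2 * (3 * binpow f 3 t'.+1) + e * (2 * binpow f 2 t'.+1))); first by ring.
    by rewrite -E3 -E2; ring.
  by rewrite rpredD ?rpredM ?U2 ?L ?rpred_nat // ltnW.
elim: t tm => [|t IHt] tm.
  by rewrite b00 binpow0 !binpow_time0 !(mulr0, addr0, subr0) expr0 subrr rpred0.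
have [-> _ _] := brec t tm; rewrite !binpowS binpow0 exprS -binpow0.
rewrite (_ : _ - _ = f * (binpow f 0 t - c * h * binpow f 2 t +
    c ^+ 2 * (3 * (h ^+ 2 * binpow f 4 t) + 2 * (e * binpow f 3 t)) - b0 t) +
   c * (t%:R * b1 t - h * binpow f 1 t +
      c * (3 * (h ^+ 2 * binpow f 3 t) + 2 * (e * binpow f 2 t)))); last by ring.
by rewrite rpredD ?rpredM ?IHt ?L1 // ltnW.
Qed.

Lemma binpow_sum f d K :
  (1 - f) * \sum_(t < K.+1) binpow f d.+1 t =
  \sum_(t < K) binpow f d t - binpow f d.+1 K * f.
Proof.
elim: K => [|K IHK].
  by rewrite big_ord_recr !big_ord0 /= binpow_time0 add0r mulr0 mul0r subr0.
rewrite big_ord_recr mulrDr IHK [in RHS]big_ord_recr /= binpowS; ring.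
Qed.

Lemma Xn_dvd_expr f t : f`_0 = 0 -> exists p, f ^+ t = 'X^t * p.
Proof.
move=> f0; have /factor_theorem [q fq] : root f 0 by rewrite /root horner_coef0 f0.
by exists (q ^+ t); rewrite fq subr0 exprMn mulrC.
Qed.

Lemma binpow_sum_eqmodX f d K : f`_0 = 0 ->
  eqmodX (K - d) ((1 - f) ^+ d.+1 * \sum_(t < K) binpow f d t) 1.
Proof.
move=> f0; elim: d K => [|d IHd] K.
  rewrite subn0 expr1; under eq_bigr do rewrite binpow0.
  rewrite -opprB mulNr -subrX1 opprB; have [p ->] := Xn_dvd_expr K f0.
  by rewrite -mulrN; apply: eqmodX_addXn.
case: K => [|K]; first by move=> j; rewrite ltn0.
rewrite exprSr -mulrA binpow_sum mulrBr subSS.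
apply: eqmodX_trans (IHd K); have [p fp] := Xn_dvd_expr (K - d) f0.
have [dK|Kd] := ltnP d K; last first.
  have -> : binpow f d.+1 K = 0 by rewrite /binpow bin_small ?ltnS // mul0r.
  by rewrite mul0r mulr0 subr0.
have -> : binpow f d.+1 K * f = 'X^(K - d) * ('C(K, d.+1)%:R * p).
  by rewrite /binpow -mulrA -exprSr mulrCA -fp -subSn.
rewrite mulrCA -mulrN; exact: eqmodX_addXn.
Qed.

(** This is the probability that a renewal process visits k in fewer than K
    steps. The argument is a recursion on the first renewal, through the identity
    1 + f (1 + f + ... + f^(K-1)) = 1 + f + ... + f^K. *)
Lemma renewal_le1 f K k : f \is a nneg -> f`_0 = 0 -> f.[1] = 1 ->
  (\sum_(t < K) f ^+ t)`_k <= 1.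
Proof.
move=> fn f0 f1; elim: K k => [|K IHK] k; first by rewrite big_ord0 coef0.
rewrite big_ord_recl expr0 coefD coef1.
under eq_bigr do rewrite exprS; rewrite -mulr_sumr.
set S := \sum_(i < K) _ in IHK *; rewrite coefM.
case: k => [|k]; first by rewrite big_ord_recl big_ord0 f0 mul0r !addr0.
rewrite add0r (le_trans (_ : _ <= \sum_(i < k.+2) f`_i)) //.
  by apply: ler_sum => i _; rewrite ler_piMr // nneg_coef.
by rewrite -f1 nneg_partial_sum_le.
Qed.

(** Truncated subtraction would give f^0 for t < d; these values must vanish
    for the sum over t to be a renewal function. *)
Definition delayed_pow f d t : {poly R} := if (d <= t)%N then f ^+ (t - d) else 0.

Lemma binpowE f d t : binpow f d t = 'C(t, d)%:R * delayed_pow f d t.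
Proof. by rewrite /binpow /delayed_pow; case: leqP => // td; rewrite bin_small // !mul0r. Qed.

Lemma delayed_pow_nneg f d t : f \is a nneg -> delayed_pow f d t \is a nneg.
Proof. by move=> fn; rewrite /delayed_pow; case: ifP => _; rewrite ?rpredX ?rpred0. Qed.

Lemma delayed_renewal_le f p d K k : f \is a nneg -> p \is a nneg ->
  f`_0 = 0 -> f.[1] = 1 -> p.[1] = 1 ->
  \sum_(t < K) (p * delayed_pow f d t)`_k <= 1.
Proof.
move=> fn pn f0 f1 p1; rewrite -coef_sum -mulr_sumr.
have -> : \sum_(t < K) delayed_pow f d t = \sum_(t < K - d) f ^+ t.
  rewrite -(big_mkord xpredT (delayed_pow f d)) -(big_mkord xpredT (fun t => f ^+ t)).
  have [dK|Kd] := leqP d K; last first.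
    rewrite (_ : (K - d = 0)%N) ?[RHS]big_geq //; last by lia.
    rewrite big1_seq // => i /andP[_]; rewrite mem_index_iota /delayed_pow => /andP[_ iK].
    by rewrite leqNgt (ltn_trans iK).
  rewrite (big_cat_nat _ dK) //= big1_seq ?add0r; last first.
    move=> i /andP[_]; rewrite mem_index_iota /delayed_pow => /andP[_ iK].
    by rewrite leqNgt iK.
  rewrite -{1}(add0n d) big_addn; apply: eq_bigr => i _.
  by rewrite /delayed_pow leq_addl addnK.
rewrite coefM (le_trans (_ : _ <= \sum_(i < k.+1) p`_i)) //.
  by apply: ler_sum => i _; rewrite ler_piMr ?nneg_coef // renewal_le1.
by rewrite -p1 nneg_partial_sum_le.
Qed.

End DistinctSteps.

(** * Hitting probabilities to second order in 1/m *)

Section WithoutReplacement.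
Variables (R : realType) (m' : nat).
Local Notation m := m'.+1.
Variable x : 'I_m -> nat.
Hypothesis x_gt0 : forall j, (0 < x j)%N.
Local Notation nneg := (polyOver (@Num.Def.nneg_num_pred R)).

Definition freq_gf i : {poly R} := m%:R^-1 *: power_gf R x i.

Lemma freq_gf_nneg i : freq_gf i \is a nneg.
Proof.
apply/polyOverP => k; rewrite unfold_in /= coefZ mulr_ge0 ?invr_ge0 //.
by rewrite coef_sum sumr_ge0 // => s _; rewrite coefXn.
Qed.

Lemma freq_gf_coef_small i k : (k < i)%N -> (freq_gf i)`_k = 0.
Proof.
move=> ki; rewrite coefZ coef_sum big1 ?mulr0 // => j _; rewrite coefXn.
by rewrite ltn_eqF // (leq_trans ki) // leq_pmulr.
Qed.

Lemma freq_gf_horner1 i : (freq_gf i).[1] = 1.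
Proof.
rewrite hornerZ horner_sum; under eq_bigr do rewrite hornerXn expr1n.
by rewrite sumr_const card_ord -[1 *+ _]/(m%:R) mulVf // pnatr_eq0.
Qed.

Local Notation f := (freq_gf 1).
Local Notation h := (freq_gf 2).
Local Notation e := (freq_gf 3).

(** The probability that t steps drawn with replacement sum to k, with the
    correction of order 1/m: a pair of equal indices among them replaces two
    factors f by h, and conditioning on distinct indices divides, to first
    order, by 1 - 'C(t, 2) / m. *)
Definition main_term k t : R :=
  (binpow f 0 t + (m%:R^-1)%:P * ((f ^+ 2 - h) * binpow f 2 t))`_k.

(** A product of factors 1 - y_i lies between 1 - s and 1 - s + s^2, where s is
    the sum of the y_i. *)
Lemma falling_bounds t : (t <= m)%N -> let s : R := 'C(t, 2)%:R / m%:R in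
  1 - s <= falling R m' t <= 1 - s + s ^+ 2.
Proof.
elim: t => [|t IHt] tm /=; first by rewrite /falling big_ord0 mul0r expr0n /= addr0 subr0 lexx.
have := IHt (ltnW tm); rewrite /= /falling big_ord_recr /= -/(falling R m' t) => /andP[h1 h2].
rewrite binS bin1 natrD mulrDl.
set s := 'C(t, 2)%:R / m%:R in h1 h2 *; set F := falling R m' t in h1 h2 *.
have s0 : 0 <= s by rewrite divr_ge0.
have y0 : 0 <= t%:R / m%:R :> R by rewrite divr_ge0.
have y1 : t%:R / m%:R <= 1 :> R by rewrite ler_pdivrMr ?ltr0n // mul1r ler_nat ltnW.
set y := t%:R / m%:R in y0 y1 *.
apply/andP; split.
  apply: (@le_trans _ _ ((1 - s) * (1 - y))); first by nra.
  by rewrite ler_wpM2r // subr_ge0.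
apply: (@le_trans _ _ ((1 - s + s ^+ 2) * (1 - y))).
  by rewrite ler_wpM2r // subr_ge0.
have : 0 <= s ^+ 2 * y by rewrite mulr_ge0 // sqr_ge0.
nra.
Qed.

Lemma step_prob_bonferroni k t : (t <= m)%N ->
  let u := (binpow f 0 t)`_k in let a := m%:R^-1 * (h * binpow f 2 t)`_k in
  u - a <= falling R m' t * step_prob R x t k <=
  u - a + m%:R^-1 ^+ 2 * (3 * (h ^+ 2 * binpow f 4 t)`_k + 2 * (e * binpow f 3 t)`_k).
Proof.
move=> tm; pose c : {poly R} := (m%:R^-1)%:P.
have cn : c \is a nneg by rewrite polyOverC unfold_in /= invr_ge0.
have [|||L U] := @bonferroni R m c f h e (distinct_gf R x 0) (distinct_gf R x 1)
   (distinct_gf R x 2) (distinct_gf R x 3) cn (freq_gf_nneg 1) (freq_gf_nneg 2)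
   (freq_gf_nneg 3) _ _ _ t tm.
- by move=> t' t'm; split; apply/polyOverP => j; apply: distinct_gf_ge0.
- exact: distinct_gf0.
- move=> t' t'm; rewrite !distinct_gf_rec //.
  have sc i : (t'%:R / m%:R) *: distinct_gf R x i t' = t'%:R * c * distinct_gf R x i t'.
    by rewrite -mul_polyC polyCM polyC_natr.
  by split; rewrite sc.
rewrite -coef_distinct_gf /=; apply/andP; split.
  by move/nneg_coefB: L => /(_ k); rewrite coefB -mulrA coefCM.
move/nneg_coefB: U => /(_ k); rewrite coefD coefB -[c * h * _]mulrA coefCM.
have cc : c ^+ 2 = (m%:R^-1 ^+ 2)%:P by rewrite rmorphXn.
by rewrite cc coefCM coefD (coef_natM 3) (coef_natM 2).
Qed.

(** Up to a factor t^4 / m^2, the probabilities met in the error terms. Their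
    sum over t is at most 4, one for each renewal process; this is what keeps
    the total error at k^4 / m^2 and not k^5 / m^2. *)
Definition error_weight k t : R :=
  (1 * delayed_pow f 0 t)`_k + (h * delayed_pow f 2 t)`_k +
  (e * delayed_pow f 3 t)`_k + (h ^+ 2 * delayed_pow f 4 t)`_k.

Lemma bin_natr_le (t d : nat) : 'C(t, d)%:R <= (t%:R ^+ d / (d`!)%:R : R).
Proof.
rewrite ler_pdivlMr ?ltr0n ?fact_gt0 // -natrM -natrX ler_nat bin_ffact.
elim: d t => [|d IHd] t //; rewrite ffactnS expnS leq_mul2l; apply/orP; right.
by apply: leq_trans (IHd _) _; case: (d) => // d'; rewrite leq_exp2r // leq_pred.
Qed.

Lemma coef_binpow (p : {poly R}) d t k :
  (p * binpow f d t)`_k = 'C(t, d)%:R * (p * delayed_pow f d t)`_k.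
Proof. by rewrite binpowE mulrCA coef_natM. Qed.

Lemma delayed_coef_ge0 p d t k : p \is a nneg -> 0 <= (p * delayed_pow f d t)`_k.
Proof. by move=> pn; rewrite nneg_coef // rpredM // delayed_pow_nneg // freq_gf_nneg. Qed.

(** With s = 'C(t, 2) / m <= 1/2, the inverse of falling t is
    1 + s + O(s^2); multiplying out the bounds of step_prob_bonferroni, the
    terms of order 1 and s form main_term and the others are of order
    s^2 <= t^4 / (4 m^2). *)
Lemma step_prob_estimate k t : (k ^ 2 <= m)%N -> (t <= k)%N ->
  `|step_prob R x t k - main_term k t| <= t%:R ^+ 4 / m%:R ^+ 2 * error_weight k t.
Proof.
move=> km tk.
have tm : (t <= m)%N by nia.
have := step_prob_bonferroni k tm; have /= := falling_bounds tm.
set F := falling R m' t; set s : R := 'C(t, 2)%:R / m%:R.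
have -> : main_term k t = (binpow f 0 t)`_k + s * (binpow f 0 t)`_k
     - m%:R^-1 * (h * binpow f 2 t)`_k.
  rewrite /main_term coefD coefCM mulrBl coefB mulrBr addrA; congr (_ + _ - _).
  rewrite coef_binpow mulrA [_ * 'C(_, _)%:R]mulrC -/s binpow0 /delayed_pow.
  have [t2|t2] := leqP 2 t; first by rewrite -exprD subnKC.
  by rewrite /s bin_small // mul0r !mul0r.
have m0 : 0 < m%:R^-1 :> R by rewrite invr_gt0 ltr0n.
rewrite !coef_binpow /error_weight.
have -> : (binpow f 0 t)`_k = (1 * delayed_pow f 0 t)`_k.
  by rewrite binpow0 /delayed_pow leq0n subn0 mul1r.
have nh := freq_gf_nneg 2; have ne := freq_gf_nneg 3.
have := @delayed_coef_ge0 1 0 t k (rpred1 _).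
have := @delayed_coef_ge0 h 2 t k nh.
have := @delayed_coef_ge0 e 3 t k ne.
have := @delayed_coef_ge0 (h ^+ 2) 4 t k (rpredX _ nh).
set u := (polyseq (1 * _))`_k; set v := (polyseq (h * _))`_k.
set w3 := (polyseq (e * _))`_k; set w4 := (polyseq (h ^+ 2 * _))`_k.
move=> w40 w30 v0 u0 /andP[F1 F2]; set E := _ ^+ 2 * _; set p := step_prob R x t k.
have -> : m%:R^-1 * ('C(t, 2)%:R * v) = s * v by rewrite /s; ring.
move=> /andP[p1 p2].
have tR0 : 0 <= t%:R :> R by [].
set T := t%:R ^+ 4 / m%:R ^+ 2.
have T0 : 0 <= T by rewrite divr_ge0 // exprn_ge0.
have s0 : 0 <= s by rewrite divr_ge0.
have sT : s ^+ 2 <= T / 4.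
  have h2 := bin_natr_le t 2; have c0 : 0 <= 'C(t, 2)%:R :> R by [].
  have -> : T / 4 = (t%:R ^+ 2 / (2`!)%:R / m%:R) ^+ 2.
    rewrite /T (_ : (2`!)%:R = 2) //; have := lt0r_neq0 m0; rewrite invr_eq0.
    by move: (m%:R : R) (t%:R : R) => M T' M0; field.
  by rewrite lerXn2r ?nnegrE ?divr_ge0 ?exprn_ge0 // ler_pM2r.
have s12 : s <= 1 / 2.
  rewrite ler_pdivrMr ?ltr0n // (le_trans (bin_natr_le t 2)) //.
  have : t%:R ^+ 2 <= m%:R :> R.
    by rewrite -natrX ler_nat (leq_trans _ km) // leq_exp2r.
  by rewrite (_ : (2`!)%:R = 2) //; lra.
have E0 : 0 <= E.
  by rewrite mulr_ge0 ?sqr_ge0 // addr_ge0 // mulr_ge0 // mulr_ge0.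
have ET : 2 * E <= T * (w3 + w4).
  have -> : T * (w3 + w4) = m%:R^-1 ^+ 2 * (t%:R ^+ 4 * w3 + t%:R ^+ 4 * w4).
    by rewrite /T exprVn; ring.
  rewrite /E mulrCA ler_wpM2l ?sqr_ge0 //.
  have h4 : 'C(t, 4)%:R * w4 <= t%:R ^+ 4 / 24 * w4.
    by rewrite ler_wpM2r // (le_trans (bin_natr_le t 4)).
  have h3 : 'C(t, 3)%:R * w3 <= t%:R ^+ 4 / 6 * w3.
    rewrite ler_wpM2r //.
    case: (t) tR0 => [|t'] _; first by rewrite expr0n mul0r.
    rewrite (le_trans (bin_natr_le _ 3)) // ler_pM2r ?invr_gt0 //.
    by rewrite ler_weXn2l // ler1n.
  have : 0 <= t%:R ^+ 4 * w4 by rewrite mulr_ge0 // exprn_ge0.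
  have : 0 <= t%:R ^+ 4 * w3 by rewrite mulr_ge0 // exprn_ge0.
  lra.
have F0 : 0 < F by apply: lt_le_trans F1; lra.
have Fle1 : F <= 1 by nra.
have q0 : 1 <= F^-1 by rewrite invf_ge1.
(* 1 + s alone need not be a lower bound for F^-1, as F may reach 1 - s + s^2. *)
have q1 : 1 - 2 * s ^+ 2 <= F^-1 - s.
  rewrite lerBrDr -[leRHS]mul1r ler_pdivlMr //.
  apply: (@le_trans _ _ ((1 - 2 * s ^+ 2 + s) * (1 - s + s ^+ 2))).
    by rewrite ler_wpM2l //; nra.
  have -> : (1 - 2 * s ^+ 2 + s) * (1 - s + s ^+ 2) =
     1 - s ^+ 2 * (2 - 3 * s + 2 * s ^+ 2) by ring.
  by rewrite gerBl mulr_ge0 ?sqr_ge0 //; nra.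
have q2 : F^-1 - 1 - s <= 2 * s ^+ 2.
  rewrite lerBlDr lerBlDr -[leLHS]mul1r ler_pdivrMr //.
  have : 0 <= s ^+ 2 by exact: sqr_ge0.
  nra.
have -> : p = (F * p) / F by rewrite mulrAC mulfV ?mul1r // gt_eqF.
set q := F^-1 in q0 q1 q2 *.
have qq : q <= 2 by nra.
have su : s ^+ 2 * u <= T / 4 * u by rewrite ler_wpM2r.
have sv : s ^+ 2 * v <= T / 4 * v by rewrite ler_wpM2r.
have Tu : 0 <= T * u by rewrite mulr_ge0.
have Tv : 0 <= T * v by rewrite mulr_ge0.
have q0' : 0 <= q by lra.
have bq1 : (u - s * v) * q <= F * p * q by rewrite ler_wpM2r.
have bq2 : F * p * q <= (u - s * v + E) * q by rewrite ler_wpM2r.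
have Eq : E * q <= 2 * E by rewrite mulrC ler_wpM2r.
have sv0 : 0 <= s * v by rewrite mulr_ge0.
have uq1 : u * (- (2 * s ^+ 2)) <= u * (q - 1 - s) by rewrite ler_wpM2l //; lra.
have uq2 : u * (q - 1 - s) <= u * (2 * s ^+ 2) by rewrite ler_wpM2l.
have vq1 : s * v * (q - 1) <= s * v * (2 * s).
  by rewrite ler_wpM2l //; nra.
have vq0 : 0 <= s * v * (q - 1) by rewrite mulr_ge0 //; lra.
have T3 : 0 <= T * (w3 + w4) by lra.
by rewrite ler_norml; apply/andP; split; lra.
Qed.

Lemma error_weight_sum k K : \sum_(t < K) error_weight k t <= 4.
Proof.
have f0 : f`_0 = 0 by exact: freq_gf_coef_small.
have bd (p : {poly R}) d : p \is a nneg -> p.[1] = 1 ->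
    \sum_(t < K) (p * delayed_pow f d t)`_k <= 1.
  by move=> pn p1; apply: delayed_renewal_le => //; rewrite ?freq_gf_nneg ?freq_gf_horner1.
rewrite !big_split /=.
have := bd 1 0 (rpred1 _) (hornerC _ _).
have := bd h 2 (freq_gf_nneg 2) (freq_gf_horner1 2).
have := bd e 3 (freq_gf_nneg 3) (freq_gf_horner1 3).
have := bd (h ^+ 2) 4 (rpredX _ (freq_gf_nneg 2)).
rewrite horner_exp freq_gf_horner1 expr1n => /(_ erefl).
lra.
Qed.

(** The weights are th t = 1 for the uniform order and th t = k / t for the
    size-biased one. *)
Lemma weighted_sum_estimate (th : nat -> R) (kappa : R) k K :
  (k ^ 2 <= m)%N -> (K <= k.+1)%N -> 0 <= kappa ->
  (forall t, (t < K)%N -> 0 <= th t /\ th t * t%:R ^+ 4 <= kappa) ->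
  `|\sum_(t < K) th t * step_prob R x t k - \sum_(t < K) th t * main_term k t| <=
  4 * kappa / m%:R ^+ 2.
Proof.
move=> km Kk k0 thP; rewrite -sumrB (le_trans (ler_norm_sum _ _ _)) //.
have w0 t : 0 <= error_weight k t.
  have nh := freq_gf_nneg 2; have ne := freq_gf_nneg 3.
  by rewrite !addr_ge0 // delayed_coef_ge0 // ?rpred1 ?rpredX.
apply: (@le_trans _ _ (\sum_(t < K) kappa / m%:R ^+ 2 * error_weight k t)).
  apply: ler_sum => t _; have [th0 th4] := thP t (ltn_ord t).
  rewrite -mulrBr normrM ger0_norm //.
  have tk : (t <= k)%N by rewrite -ltnS (leq_trans (ltn_ord t)).
  rewrite (le_trans (ler_wpM2l th0 (step_prob_estimate km tk))) //.
  rewrite [leLHS]mulrA; apply: ler_wpM2r => //.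
  by rewrite mulrA ler_wpM2r // invr_ge0 exprn_ge0.
rewrite -mulr_sumr -[leRHS]mulrA mulrC ler_wpM2r ?error_weight_sum //.
by rewrite divr_ge0 // exprn_ge0.
Qed.

Lemma main_term_small k t : (k < t)%N -> main_term k t = 0.
Proof.
move=> kt; have f0 : f`_0 = 0 by exact: freq_gf_coef_small.
have fs p d : (k < d)%N -> (f ^+ d * p)`_k = 0.
  by move=> kd; have [q ->] := Xn_dvd_expr d f0; rewrite -mulrA mulrC coefMXn kd.
rewrite /main_term binpow0 coefD -[f ^+ t]mulr1 fs // add0r coefCM.
have [t2|t2] := ltnP t 2.
  by rewrite /binpow bin_small // mul0r mulr0 coef0 mulr0.
rewrite mulrBl coefB !coef_binpow /delayed_pow t2.
rewrite -exprD subnKC // -[f ^+ t]mulr1 fs // mulr0 sub0r.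
have [q qE] : exists q, h = 'X^2 * q.
  exists (\poly_(i < size h) h`_(i + 2)); apply/polyP => i; rewrite mulrC coefMXn.
  case: ltnP => i2; first by rewrite freq_gf_coef_small.
  rewrite coef_poly subnK //; case: ltnP => // si.
  by rewrite nth_default // (leq_trans si) // leq_subr.
have [q' ->] := Xn_dvd_expr (t - 2) f0.
by rewrite qE mulrACA -exprD subnKC // (mulrC ('X^t)) coefMXn kt mulr0 oppr0 mulr0.
Qed.

Lemma main_term_sum k K : (k < K)%N ->
  \sum_(t < k.+1) main_term k t =
  (\sum_(t < K) f ^+ t)`_k + ((f ^+ 2 - h) * \sum_(t < K) binpow f 2 t)`_k / m%:R.
Proof.
move=> kK; rewrite -!(big_mkord xpredT (main_term k)).
transitivity (\sum_(0 <= t < K) main_term k t).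
  rewrite [RHS](big_cat_nat _ kK) //= [X in _ + X]big1_seq ?addr0 // => t.
  by rewrite mem_index_iota => /andP[_ /andP[kt _]]; rewrite main_term_small.
rewrite big_mkord; under eq_bigr do rewrite /main_term coefD coefCM binpow0.
by rewrite big_split /= -coef_sum -mulr_sumr -coef_sum -mulr_sumr mulrC.
Qed.

(** The factor k / t is absorbed by differentiation in the leading term, since
    k [z^k] f^t = t [z^k] z f' f^(t-1), and by 'C(t, 2) / t = (t - 1) / 2 in
    the correction. *)
Lemma size_biased_main_term_sum k K : (k < K)%N ->
  \sum_(t < k.+1) k%:R / t%:R * main_term k t =
  ('X * f^`() * \sum_(t < K) f ^+ t)`_k +
  k%:R / 2 * ((f ^+ 2 - h) * \sum_(t < K) binpow f 1 t)`_k / m%:R.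
Proof.
move=> kK.
transitivity (\sum_(t < K.+1) k%:R / t%:R * main_term k t).
  rewrite -!(big_mkord xpredT (fun t => k%:R / t%:R * main_term k t)).
  rewrite [RHS](@big_cat_nat _ _ _ k.+1) //=; last exact: leqW.
  rewrite [X in _ + X]big1_seq ?addr0 // => t.
  rewrite mem_index_iota => /andP[_ /andP[kt _]]; by rewrite main_term_small ?mulr0.
(* Time 0 drops out on the left because k / 0 = 0. *)
rewrite big_ord_recl invr0 mulr0 mul0r add0r.
rewrite !mulr_sumr !coef_sum mulr_sumr mulr_suml -big_split /=.
apply: eq_bigr => t _; rewrite /bump /= add1n /main_term coefD mulrDr; congr (_ + _).
  have t0 : t.+1%:R != 0 :> R by rewrite pnatr_eq0.
  have E : k%:R * (f ^+ t.+1)`_k = t.+1%:R * ('X * f^`() * f ^+ t)`_k.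
    have : ('X * (f ^+ t.+1)^`())`_k = k%:R * (f ^+ t.+1)`_k.
      rewrite coefXM coef_deriv; case: (k) => [|k']; first by rewrite mul0r.
      by rewrite /= mulr_natl.
    by move=> <-; rewrite deriv_exp /= mulrnAr coefMn mulrA mulr_natl.
  by rewrite binpow0 mulrAC E mulrAC mulfV // mul1r.
rewrite coefCM.
have t0 : t.+1%:R != 0 :> R by rewrite pnatr_eq0.
have E : t.+1%:R * ((f ^+ 2 - h) * binpow f 1 t)`_k = 2 * ((f ^+ 2 - h) * binpow f 2 t.+1)`_k.
  by rewrite -coef_natM -(coef_natM 2) mulrCA mul_binpow mulrCA.
set A := (polyseq (_ * binpow f 1 t))`_k in E *.
set B := (polyseq (_ * binpow f 2 _))`_k in E *.
have -> : B = t.+1%:R * A / 2 by rewrite E mulrAC mulfV ?mul1r // pnatr_eq0.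
have m0 : m%:R != 0 :> R by rewrite pnatr_eq0.
move: t0 m0; move: (t.+1%:R : R) (m%:R : R) => T M T0 M0.
by field; rewrite T0 M0.
Qed.

Lemma hit_prob_expansion k K : (0 < k < K)%N -> (k ^ 2 <= m)%N ->
  `|hit_prob R x k - ((\sum_(t < K) f ^+ t)`_k +
     ((f ^+ 2 - h) * \sum_(t < K) binpow f 2 t)`_k / m%:R)| <=
  4 * (k%:R ^+ 4 / m%:R ^+ 2).
Proof.
move=> /andP[k0 kK] km; have km' : (k <= m)%N by nia.
rewrite hit_prob_sum // -main_term_sum //.
have -> : \sum_(t < k) step_prob R x t.+1 k = \sum_(t < k.+1) 1 * step_prob R x t k.
  rewrite big_ord_recl /= [X in 1 * X](_ : _ = 0) ?mulr0 ?add0r; last first.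
    rewrite /step_prob [visits _ _ _]eq_card0 ?mul0r // => s.
    by rewrite !inE partial_sum0 ltn_eqF.
  by apply: eq_bigr => t _; rewrite mul1r.
have -> : \sum_(t < k.+1) main_term k t = \sum_(t < k.+1) 1 * main_term k t.
  by apply: eq_bigr => t _; rewrite mul1r.
rewrite [leRHS]mulrA; apply: (@weighted_sum_estimate (fun=> 1) (k%:R ^+ 4) k k.+1) => //.
move=> t tk; split; first exact: ler01.
by rewrite mul1r lerXn2r ?nnegrE // ler_nat.
Qed.

Lemma size_biased_hit_prob_expansion n k K : (0 < k < K)%N -> (k ^ 2 <= m)%N ->
  (\sum_(j < m) x j)%N = n ->
  `|size_biased_hit_prob R x k - m%:R / n%:R * (('X * f^`() * \sum_(t < K) f ^+ t)`_k +
     k%:R / 2 * ((f ^+ 2 - h) * \sum_(t < K) binpow f 1 t)`_k / m%:R)| <=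
  4 * (k%:R ^+ 4 / m%:R ^+ 2).
Proof.
move=> /andP[k0 kK] km xn; have km' : (k <= m)%N by nia.
rewrite (@size_biased_hit_prob_sum R m' x x_gt0 n k km' xn) -size_biased_main_term_sum //.
have -> : \sum_(t < k) k%:R / t.+1%:R * step_prob R x t.+1 k =
    \sum_(t < k.+1) k%:R / t%:R * step_prob R x t k.
  by rewrite big_ord_recl /= invr0 mulr0 mul0r add0r.
rewrite -mulrBr normrM ger0_norm ?divr_ge0 //.
have mn : m%:R / n%:R <= 1 :> R.
  have mn : (m <= n)%N.
    by rewrite -xn -{1}(card_ord m) -sum1_card leq_sum.
  by rewrite ler_pdivrMr ?mul1r ?ler_nat // ltr0n (leq_trans _ mn).
rewrite -[leRHS]mul1r ler_pM ?divr_ge0 //.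
rewrite [leRHS]mulrA; apply: (@weighted_sum_estimate (fun t => k%:R / t%:R) (k%:R ^+ 4) k k.+1) => //.
move=> t tk; split; first exact: divr_ge0.
have [->|t0] := eqVneq t 0%N; first by rewrite expr0n mulr0 exprn_ge0.
have t0' : t%:R != 0 :> R by rewrite pnatr_eq0.
rewrite [t%:R ^+ 4]exprS mulrA divfK // [leRHS]exprS ler_wpM2l //.
by rewrite lerXn2r ?nnegrE // ler_nat.
Qed.

End WithoutReplacement.

(** * Probability generating functions near 1 *)

Section ProbabilityGeneratingFunction.
Variable R : realType.
Local Notation C := R[i].
Local Notation nneg := (polyOver (@Num.Def.nneg_num_pred R)).
Local Notation toC := (map_poly (real_complex R)).
Implicit Types (F T W : {poly R}) (z : C) (r M d c delta : R).

Lemma normc_nat n : normc (n%:R : C) = n%:R.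
Proof. by rewrite -(rmorph_nat (real_complex R)) normc_real normr_nat. Qed.

Lemma normc_expB1 z (rho : R) l : 1 <= rho -> normc z <= rho ->
  normc (z ^+ l - 1) <= l%:R * rho ^+ l * normc (z - 1).
Proof.
move=> rho1 zr; elim: l => [|l IHl]; first by rewrite expr0 subrr normc0 !mul0r.
have -> : z ^+ l.+1 - 1 = (z ^+ l - 1) * z + (z - 1) by rewrite exprSr; ring.
rewrite (le_trans (le_normcD _ _)) // normcM.
have rl : 1 <= rho ^+ l.+1 by rewrite exprn_ege1.
have zz := normc_ge0 z; have y0 := normc_ge0 (z - 1).
have : normc (z ^+ l - 1) * normc z <= l%:R * rho ^+ l * normc (z - 1) * rho.
  by rewrite ler_pM ?normc_ge0.
have : normc (z - 1) <= rho ^+ l.+1 * normc (z - 1) by rewrite ler_peMl.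
rewrite exprSr -natr1; set y := normc (z - 1); set q := normc _ * _; set p := rho ^+ l.
nra.
Qed.

Lemma normc_exp_taylor z (rho : R) l : 1 <= rho -> normc z <= rho ->
  normc (z ^+ l - 1 - l%:R * (z - 1)) <= 'C(l, 2)%:R * rho ^+ l * normc (z - 1) ^+ 2.
Proof.
move=> rho1 zr; elim: l => [|l IHl]; first by rewrite expr0 subrr mul0r subrr normc0 !mul0r.
have -> : z ^+ l.+1 - 1 - l.+1%:R * (z - 1) =
    (z ^+ l - 1 - l%:R * (z - 1)) + (z ^+ l - 1) * (z - 1).
  by rewrite exprSr -natr1; ring.
rewrite (le_trans (le_normcD _ _)) // normcM.
have h2 := ler_wpM2r (normc_ge0 (z - 1)) (normc_expB1 l rho1 zr).
rewrite (le_trans (lerD IHl h2)) //.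
rewrite [leLHS](_ : _ = ('C(l, 2)%:R + l%:R) * rho ^+ l * normc (z - 1) ^+ 2); last by ring.
rewrite binS bin1 natrD ler_wpM2r ?exprn_ge0 ?normc_ge0 // ler_wpM2l ?addr_ge0 //.
by rewrite ler_weXn2l.
Qed.

Lemma toC_horner F (x : R) : (toC F).[x%:C] = (F.[x])%:C.
Proof. by rewrite horner_map. Qed.

Lemma toC_horner1 F : (toC F).[1] = (F.[1])%:C.
Proof. by rewrite -toC_horner. Qed.

Lemma normc_toC_le F z (rho : R) : F \is a nneg -> normc z <= rho ->
  normc (toC F).[z] <= F.[rho].
Proof.
move=> Fn zr; rewrite (le_trans (normc_horner _ _)) // size_map_poly horner_coef.
apply: ler_sum => i _; rewrite coef_map normc_real ger0_norm ?nneg_coef //.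
by rewrite ler_wpM2l ?nneg_coef // lerXn2r ?nnegrE ?normc_ge0 // (le_trans _ zr) ?normc_ge0.
Qed.

Lemma deriv_horner1 F : F^`().[1] = \sum_(i < size F) F`_i * i%:R.
Proof.
rewrite -{1}[F]coefK poly_def raddf_sum horner_sum; apply: eq_bigr => i _.
by rewrite /= derivZ derivXn hornerZ hornerMn hornerXn expr1n.
Qed.

(** The second-order coefficients 'C(l, 2) rho^l of the Taylor remainder at 1
    are absorbed by the larger radius rho^2, because (rho - 1)^2 'C(l, 2) is at
    most rho^l. *)
Lemma pgf_taylor1 F rho z : F \is a nneg -> F.[1] = 1 -> 1 < rho -> normc z <= rho ->
  normc ((toC F).[z] - 1 - (F^`().[1])%:C * (z - 1)) <=
  F.[rho ^+ 2] / (rho - 1) ^+ 2 * normc (z - 1) ^+ 2.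
Proof.
move=> Fn F1 rho1 zr.
have h0 : 0 < rho - 1 by rewrite subr_gt0.
have h2 : 0 < (rho - 1) ^+ 2 by rewrite exprn_gt0.
have F1E : (F^`().[1])%:C = \sum_(i < size F) (F`_i)%:C * i%:R.
  rewrite deriv_horner1 rmorph_sum; apply: eq_bigr => i _.
  by rewrite rmorphM /= rmorph_nat.
have -> : (toC F).[z] - 1 - (F^`().[1])%:C * (z - 1) =
    \sum_(i < size F) (F`_i)%:C * (z ^+ i - 1 - i%:R * (z - 1)).
  have E1 : 1 = \sum_(i < size F) (F`_i)%:C.
    rewrite -rmorph_sum -(rmorph1 (real_complex R)) -[in LHS]F1 horner_coef; congr (_%:C).
    by apply: eq_bigr => i _; rewrite expr1n mulr1.
  rewrite F1E horner_coef size_map_poly mulr_suml [X in _ - X - _]E1 -!sumrB.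
  apply: eq_bigr => i _.
  by rewrite coef_map /=; ring.
rewrite (le_trans (normc_sum _ _ _)) // horner_coef !mulr_suml; apply: ler_sum => i _.
rewrite normcM normc_real ger0_norm ?nneg_coef // -!mulrA ler_wpM2l ?nneg_coef //.
rewrite (le_trans (normc_exp_taylor i (ltW rho1) zr)) // mulrA ler_wpM2r //.
  by rewrite exprn_ge0 // normc_ge0.
rewrite -exprM mul2n -addnn exprD ler_pdivlMr // mulrAC ler_wpM2r //.
  by rewrite exprn_ge0 // (le_trans ler01) // ltW.
elim: (nat_of_ord i) => [|l IHl]; first by rewrite bin0n mul0r expr0 ler01.
have B : 1 + l%:R * (rho - 1) <= rho ^+ l.
  elim: (l) => [|l' IHl']; first by rewrite mul0r addr0.
  rewrite exprS; apply: le_trans (_ : rho * (1 + l'%:R * (rho - 1)) <= _).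
    have : 0 <= l'%:R * (rho - 1) ^+ 2 by rewrite mulr_ge0 // sqr_ge0.
    by rewrite -natr1; lra.
  by rewrite ler_wpM2l // (le_trans ler01) // ltW.
rewrite binS bin1 natrD [leRHS]exprS.
have l0 : 0 <= l%:R :> R by [].
have := ler_wpM2l (ltW h0) B; move: IHl h0.
move: ('C(l, 2)%:R : R) (l%:R : R) (rho ^+ l) => a b q IHl h0 hB.
lra.
Qed.

Lemma pgf_mean_ge1 F : F \is a nneg -> F`_0 = 0 -> F.[1] = 1 -> 1 <= F^`().[1].
Proof.
move=> Fn F0 F1; rewrite -[leLHS]F1 deriv_horner1 horner_coef; apply: ler_sum => i _.
rewrite expr1n; case: (nat_of_ord i) => [|j]; first by rewrite F0 !mul0r.
by rewrite ler_wpM2l ?nneg_coef // ler1n.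
Qed.

Lemma pgf_quotient F : F.[1] = 1 -> exists T, 1 - F = (1 - 'X) * T /\ T.[1] = F^`().[1].
Proof.
move=> F1; have /factor_theorem[q qF] : root (F - 1) 1.
  by rewrite /root !hornerE F1 subrr.
have -> : F = q * ('X - 1) + 1 by rewrite -polyC1 -qF polyC1 subrK.
exists q; split; first by ring.
rewrite !poly.derivE !hornerE /=; ring.
Qed.

(** F^2 and F(z^2) have the same value and the same derivative at 1, so their
    difference vanishes there to order 2; half its second derivative is the
    value of W at 1. *)
Lemma double_root_quotient F : F.[1] = 1 ->
  exists W, F ^+ 2 - (F \Po 'X^2) = (1 - 'X) ^+ 2 * W /\
    W.[1] = F^`().[1] ^+ 2 - F^`().[1] - F^`(2).[1].
Proof.
move=> F1; set q := F ^+ 2 - _.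
have q0 : root q 1.
  rewrite /root /q. rewrite !(hornerE, horner_comp). by rewrite F1 !expr1n F1 subrr.
have [q1 qq1] := factor_theorem _ _ q0.
have dq : q^`() = F^`() * F *+ 2 - (F^`() \Po 'X^2) * ('X *+ 2).
  rewrite /q !poly.derivE deriv_comp !poly.derivE /=; ring.
have q10 : root q1 1.
  have := congr1 (fun p : {poly R} => p^`().[1]) qq1.
  rewrite /= dq !poly.derivE !(hornerE, horner_comp) /= expr1n F1 => h.
  rewrite /root; apply/eqP; move: h; set a := F^`().[1]; set b := q1.[1]; set b' := q1^`().[1].
  by lra.
have [W W1] := factor_theorem _ _ q10; exists W; split.
  by rewrite qq1 W1 polyC1; ring.
have := congr1 (fun p : {poly R} => p^`()^`().[1]) qq1.
rewrite /= dq W1 polyC1 !poly.derivE !deriv_comp !poly.derivE !(hornerE, horner_comp) /= F1.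
rewrite !expr1n.
lra.
Qed.

(** Away from 1 the bound is the assumed one on 1 - F. Near 1 it comes from
    the mean of F, which is at least 1: there 1 - F differs from
    mean * (1 - z) by at most (M / h^2) |1 - z|^2, which is at most |1 - z| / 2
    by the choice of delta. *)
Lemma pgf_quotient_lower_bound F T r M c delta :
  F \is a nneg -> F`_0 = 0 -> F.[1] = 1 -> 1 < r -> F.[r] <= M -> 0 < M -> 0 < c ->
  1 - F = (1 - 'X) * T ->
  let h := Num.sqrt r - 1 in delta <= h -> delta <= h ^+ 2 / (2 * M) ->
  (forall z, normc z <= r -> delta <= normc (z - 1) -> c <= normc (1 - (toC F).[z])) ->
  forall z, normc z <= r -> Num.min 2^-1 (c / (r + 1)) <= normc (toC T).[z].
Proof.
move=> Fn F0 F1 r1 FM M0 c0 TE h dh dM cP z zr.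
have r0 : 0 < r by exact: lt_trans r1.
have rho1 : 1 < Num.sqrt r by rewrite -sqrtr1 ltr_sqrt.
have rho2 : Num.sqrt r ^+ 2 = r by rewrite sqr_sqrtr // ltW.
have h0 : 0 < h by rewrite subr_gt0.
have mu1 := pgf_mean_ge1 Fn F0 F1.
have TEz : 1 - (toC F).[z] = (1 - z) * (toC T).[z].
  have := congr1 (fun p => (toC p).[z]) TE.
  by rewrite /= rmorphM !rmorphB /= rmorph1 map_polyX hornerM !hornerE.
have [dz|zd] := leP delta (normc (z - 1)).
  rewrite ge_min; apply/orP; right; rewrite ler_pdivrMr ?addr_gt0 //.
  rewrite (le_trans (cP z zr dz)) // TEz normcM mulrC ler_wpM2l ?normc_ge0 //.
  by rewrite (le_trans (le_normcD _ _)) // normc1 normcN addrC lerD.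
rewrite ge_min; apply/orP; left.
have [z1|z1] := eqVneq z 1.
  have [T' [T'E T'1]] := pgf_quotient F1.
  have TT' : T = T'.
    apply: (mulfI (_ : (1 - 'X : {poly R}) != 0)); last by rewrite -TE -T'E.
    by rewrite -opprB oppr_eq0 -polyC1 polyXsubC_eq0.
  by rewrite z1 toC_horner1 TT' T'1 normc_real ger0_norm; lra.
have z10 : 0 < normc (z - 1) by rewrite normc_gt0 subr_eq0.
have zrho : normc z <= Num.sqrt r.
  rewrite -(subrK 1 z) (le_trans (le_normcD _ _)) // normc1 -lerBrDr.
  by rewrite (le_trans (ltW zd)).
have := pgf_taylor1 Fn F1 rho1 zrho; rewrite rho2 -/h.
set A := (toC F).[z] - 1; set B := _%:C * _ => AB.
have nB : normc (z - 1) <= normc B.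
  by rewrite /B normcM normc_real ler_peMl ?normc_ge0 // (le_trans mu1) // ler_norm.
have nA : normc A = normc (z - 1) * normc (toC T).[z].
  by rewrite /A normc_distC TEz normcM normc_distC.
rewrite -(ler_pM2l z10) -nA.
have BA : normc B - normc A <= normc (A - B) by rewrite (normc_distC A) le_normcB.
have small : F.[r] / h ^+ 2 * normc (z - 1) ^+ 2 <= normc (z - 1) / 2.
  rewrite expr2 mulrA [leRHS]mulrC ler_wpM2r ?normc_ge0 //.
  apply: (@le_trans _ _ (M / h ^+ 2 * (h ^+ 2 / (2 * M)))).
    apply: ler_pM => //; rewrite ?normc_ge0 //.
    - rewrite divr_ge0 ?sqr_ge0 // horner_coef sumr_ge0 // => i _.
      by rewrite mulr_ge0 ?nneg_coef // exprn_ge0 // ltW.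
    - by rewrite ler_wpM2r // invr_ge0 sqr_ge0.
    - by rewrite (le_trans (ltW zd)).
  have -> : M / h ^+ 2 * (h ^+ 2 / (2 * M)) = 2^-1.
    by field; rewrite !gt_eqF.
  by [].
lra.
Qed.

End ProbabilityGeneratingFunction.

(** * Hitting probabilities from bounds on the generating function *)

Section HittingEstimates.
Variables (R : realType) (m' : nat).
Local Notation m := m'.+1.
Variable x : 'I_m -> nat.
Hypothesis x_gt0 : forall j, (0 < x j)%N.
Local Notation toC := (map_poly (real_complex R)).
Local Notation nneg := (polyOver (@Num.Def.nneg_num_pred R)).
Local Notation F := (freq_gf R x 1).

Lemma freq_gf2 : freq_gf R x 2 = F \Po 'X^2.
Proof.
rewrite comp_polyZ; congr (_ *: _); rewrite /power_gf raddf_sum /=.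
by apply: eq_bigr => j _; rewrite mul1n comp_Xn_poly -exprM.
Qed.

Lemma freq_gf_deriv1 n : (\sum_(j < m) x j)%N = n -> F^`().[1] = n%:R / m%:R.
Proof.
move=> xn; rewrite derivZ hornerZ /power_gf raddf_sum /= horner_sum mulrC; congr (_ / _).
rewrite -xn natr_sum; apply: eq_bigr => j _.
by rewrite mul1n derivXn hornerMn hornerXn expr1n.
Qed.

(** From here on everything is uniform in x, given the bounds M and M' on F and
    F' at r and the lower bound d for T on the disc. *)
Variables (r M M' d : R) (T : {poly R}).
Hypotheses (r1 : 1 < r) (FM : F.[r] <= M) (FM' : F^`().[r] <= M') (d0 : 0 < d).
Hypotheses (TE : 1 - F = (1 - 'X) * T)
  (dT : forall z, normc z <= r -> d <= normc (toC T).[z]).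
Local Notation mu := (F^`().[1]).
Local Notation rho := (Num.sqrt r).

Let F_nneg : F \is a nneg. Proof. exact: freq_gf_nneg. Qed.
Let F0 : F`_0 = 0. Proof. exact: freq_gf_coef_small. Qed.
Let F1 : F.[1] = 1. Proof. exact: freq_gf_horner1. Qed.
Let mu_ge1 : 1 <= mu. Proof. exact: pgf_mean_ge1. Qed.
Let r_gt0 : 0 < r. Proof. exact: lt_trans r1. Qed.
Let rho1 : 1 < rho. Proof. by rewrite -sqrtr1 ltr_sqrt. Qed.
Let rho0 : 0 < rho. Proof. exact: lt_trans rho1. Qed.
Let rho2 : rho ^+ 2 = r. Proof. by rewrite sqr_sqrtr // ltW. Qed.
Let rho_le_r : rho <= r.
Proof. by rewrite -{2}rho2 expr2 ler_peMl // ltW. Qed.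

Let T1 : T.[1] = mu.
Proof.
have [T' [T'E <-]] := pgf_quotient F1; congr (_.[_]).
apply: (mulfI (_ : (1 - 'X : {poly R}) != 0)); last by rewrite -TE -T'E.
by rewrite -opprB oppr_eq0 -polyC1 polyXsubC_eq0.
Qed.

Lemma eqmodX_toC n (p q : {poly R}) : eqmodX n p q -> eqmodX n (toC p) (toC q).
Proof. by move=> pq j jn; rewrite !coef_map /= pq. Qed.

Lemma power_quotient_coef s (N Y : {poly R}) (sg B : R) k :
  0 < sg -> sg <= r -> (forall z, normc z = sg -> normc (toC N).[z] <= B) ->
  eqmodX k.+1 (T ^+ s * Y) N -> `|Y`_k| <= B / d ^+ s / sg ^+ k.
Proof.
move=> sg0 sgr NB YN; rewrite -normc_real -[_%:C](coef_map (real_complex R)).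
apply: (@quotient_coef R (toC (T ^+ s)) (toC N) _ sg (d ^+ s)) => //.
- by rewrite exprn_gt0.
- move=> z zr; rewrite rmorphXn horner_exp normcX lerXn2r ?nnegrE ?normc_ge0 ?(ltW d0) //.
  by rewrite dT // (le_trans zr).
- move=> z zr; rewrite (le_trans (NB z zr)) // mulrAC ler_pdivlMr ?exprn_gt0 //.
  have B0 : 0 <= B by rewrite (le_trans _ (NB z zr)) ?normc_ge0.
  rewrite ler_wpM2l // rmorphXn horner_exp normcX lerXn2r ?nnegrE ?normc_ge0 ?(ltW d0) //.
  by rewrite dT // zr.
- by rewrite -rmorphM; apply: eqmodX_toC.
Qed.

Lemma power_quotient_partial_sum s (N Y : {poly R}) (sg B : R) k :
  1 < sg -> sg <= r -> (forall z, normc z = sg -> normc (toC N).[z] <= B) ->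
  eqmodX k.+1 ((1 - 'X) * T ^+ s * Y) N ->
  `|Y`_k - N.[1] / mu ^+ s| <= B / d ^+ s / (sg - 1) / sg ^+ k.
Proof.
move=> sg1 sgr NB YN; rewrite -normc_real rmorphB rmorphM fmorphV rmorphXn /=.
rewrite -T1 -!toC_horner1 -[(Y`_k)%:C](coef_map (real_complex R)) -horner_exp -rmorphXn.
apply: (@quotient_partial_sum R (toC (T ^+ s)) (toC N) _ sg (d ^+ s)) => //.
- by rewrite exprn_gt0.
- move=> z zr; rewrite rmorphXn horner_exp normcX lerXn2r ?nnegrE ?normc_ge0 ?(ltW d0) //.
  by rewrite dT // (le_trans zr).
- move=> z zr; rewrite (le_trans (NB z zr)) // mulrAC ler_pdivlMr ?exprn_gt0 //.
  have B0 : 0 <= B by rewrite (le_trans _ (NB z zr)) ?normc_ge0.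
  rewrite ler_wpM2l // rmorphXn horner_exp normcX lerXn2r ?nnegrE ?normc_ge0 ?(ltW d0) //.
  by rewrite dT // zr.
- have -> : (1 - 'X : {poly R[i]}) = toC (1 - 'X) by rewrite rmorphB /= rmorph1 map_polyX.
  by rewrite -!rmorphM; apply: eqmodX_toC.
Qed.

Let oneX0 s : ((1 - 'X : {poly R}) ^+ s)`_0 != 0.
Proof. by rewrite -horner_coef0 horner_exp !hornerE subr0 expr1n oner_eq0. Qed.

(* The sum up to k.+3 leaves a remainder divisible by 'X^(k.+3 - d'), which is
   beyond degree k for the three values of d' that occur. *)
Let inv_eqmodX k d' : (d' <= 2)%N ->
  eqmodX k.+1 ((1 - 'X) ^+ d'.+1 * T ^+ d'.+1 * \sum_(t < k.+3) binpow F d' t) 1.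
Proof.
move=> d2; rewrite -exprMn -TE.
apply: (@eqmodX_leq _ _ (k.+3 - d')); first by lia.
exact: binpow_sum_eqmodX.
Qed.

Lemma renewal_sum_estimate k :
  `|(\sum_(t < k.+3) F ^+ t)`_k - mu^-1| <= d^-1 / (r - 1) / r ^+ k.
Proof.
have := @power_quotient_partial_sum 1 1 (\sum_(t < k.+3) F ^+ t) r 1 k r1 (lexx _).
rewrite hornerC div1r expr1 mul1r; apply.
  by move=> z _; rewrite rmorph1 hornerC normc1.
have := @inv_eqmodX k 0 isT; rewrite !expr1.
by under eq_bigr do rewrite binpow0.
Qed.

Lemma delay_sum_estimate k :
  `|('X * F^`() * \sum_(t < k.+3) F ^+ t)`_k - 1| <= r * M' / d / (r - 1) / r ^+ k.
Proof.
have := @power_quotient_partial_sum 1 ('X * F^`()) ('X * F^`() * \sum_(t < k.+3) F ^+ t)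
  r (r * M') k r1 (lexx _).
rewrite hornerM hornerX mul1r expr1 divff ?gt_eqF ?(lt_le_trans ltr01) //; apply.
  move=> z zr; rewrite rmorphM /= map_polyX hornerM hornerX normcM zr ler_wpM2l ?(ltW r_gt0) //.
  by rewrite (le_trans _ FM') // normc_toC_le ?zr // polyOver_deriv.
have := @inv_eqmodX k 0 isT; rewrite !expr1 => /(@eqmodX_mul2l _ _ ('X * F^`())).
rewrite mulr1 mulrCA; under eq_bigr do rewrite binpow0.
by [].
Qed.

(** The radius is the square root of r because F(z^2) is controlled by F(r)
    only up to there. *)
Let numerator_bound W : F ^+ 2 - (F \Po 'X^2) = (1 - 'X) ^+ 2 * W ->
  forall z, normc z = rho -> normc (toC W).[z] <= (M ^+ 2 + M) / (rho - 1) ^+ 2.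
Proof.
move=> WE z zr.
have h0 : 0 < rho - 1 by rewrite subr_gt0.
have := congr1 (fun p => (toC p).[z]) WE.
rewrite /= rmorphM rmorphXn !rmorphB /= rmorph1 map_polyX hornerM horner_exp rmorphXn.
rewrite map_comp_poly map_polyXn !(hornerE, horner_comp) => E.
have fM y : normc y <= r -> normc (toC F).[y] <= M.
  by move=> yr; rewrite (le_trans _ FM) // normc_toC_le.
have nz : rho - 1 <= normc (1 - z).
  by rewrite normc_distC -{1}zr -[X in _ - X](normc1 R) le_normcB.
rewrite ler_pdivlMr ?exprn_gt0 //.
apply: (@le_trans _ _ (normc (toC W).[z] * normc (1 - z) ^+ 2)).
  rewrite ler_wpM2l ?normc_ge0 // lerXn2r ?nnegrE ?normc_ge0 ?(ltW h0) //.
rewrite mulrC -normcX -normcM -E (le_trans (le_normcD _ _)) // normcN lerD //.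
  rewrite normcX lerXn2r ?nnegrE ?normc_ge0 ?fM ?zr //.
  by rewrite (le_trans _ (fM z _)) ?normc_ge0 ?zr.
by rewrite fM // normcX zr rho2.
Qed.

Let K2 := (M ^+ 2 + M) / (rho - 1) ^+ 2.

(** A triple pole against a double zero leaves the simple pole of
    W / ((1 - z) T^3). *)
Lemma second_order_estimate k :
  `|((F ^+ 2 - freq_gf R x 2) * \sum_(t < k.+3) binpow F 2 t)`_k -
     (mu ^+ 2 - mu - F^`(2).[1]) / mu ^+ 3| <= K2 / d ^+ 3 / (rho - 1) / rho ^+ k.
Proof.
rewrite freq_gf2; have [W [WE <-]] := double_root_quotient F1.
apply: power_quotient_partial_sum => //; first exact: numerator_bound.
apply: (@eqmodX_mulI _ _ ((1 - 'X) ^+ 2)) => //.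
rewrite -WE -[X in eqmodX _ _ X]mulr1.
have := @eqmodX_mul2l _ _ (F ^+ 2 - (F \Po 'X^2)) _ _ (@inv_eqmodX k 2 isT).
by congr eqmodX; ring.
Qed.

(** Here the double zero cancels the double pole, and W / T^2 is analytic on the
    disc: under size-biasing the correction of order 1/m disappears. *)
Lemma size_biased_second_order_estimate k :
  `|((F ^+ 2 - freq_gf R x 2) * \sum_(t < k.+3) binpow F 1 t)`_k| <=
  K2 / d ^+ 2 / rho ^+ k.
Proof.
rewrite freq_gf2; have [W [WE _]] := double_root_quotient F1.
apply: (power_quotient_coef (N := W)) => //; first exact: numerator_bound.
apply: (@eqmodX_mulI _ _ ((1 - 'X) ^+ 2)) => //.
rewrite -WE -[X in eqmodX _ _ X]mulr1.
have := @eqmodX_mul2l _ _ (F ^+ 2 - (F \Po 'X^2)) _ _ (@inv_eqmodX k 1 isT).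
by congr eqmodX; ring.
Qed.

Lemma hit_prob_estimate n k : (\sum_(j < m) x j)%N = n -> (0 < k)%N -> (k ^ 2 <= m)%N ->
  `|hit_prob R x k - m%:R / n%:R + (mu - mu ^+ 2 + F^`(2).[1]) / (mu ^+ 3 * m%:R)| <=
  d^-1 / (r - 1) / r ^+ k + K2 / d ^+ 3 / (rho - 1) / rho ^+ k / m%:R +
  4 * (k%:R ^+ 4 / m%:R ^+ 2).
Proof.
move=> xn k0 km.
have kK : (0 < k < k.+3)%N by rewrite k0 /=; lia.
have h1 := hit_prob_expansion R x_gt0 kK km.
have h2 := renewal_sum_estimate k; have h3 := second_order_estimate k.
have -> : m%:R / n%:R = mu^-1 by rewrite (freq_gf_deriv1 xn) invf_div.
have m0 : 0 < m%:R :> R by rewrite ltr0n.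
have mu0 : mu != 0 by rewrite gt_eqF // (lt_le_trans ltr01).
move: h1 h2 h3; set p := hit_prob R x k; set A := (\sum_(t < k.+3) F ^+ t)`_k.
set B := (polyseq (_ * _))`_k; set V := F^`(2).[1] => h1 h2 h3.
have -> : p - mu^-1 + (mu - mu ^+ 2 + V) / (mu ^+ 3 * m%:R) =
    (A - mu^-1) + (B - (mu ^+ 2 - mu - V) / mu ^+ 3) / m%:R + (p - (A + B / m%:R)).
  move: m0 => /lt0r_neq0; move: (m%:R : R) => N N0.
  by field; rewrite N0 mu0.
rewrite (le_trans (ler_normD _ _)) // lerD // (le_trans (ler_normD _ _)) // lerD //.
by rewrite normrM (ger0_norm (_ : 0 <= m%:R^-1)) ?invr_ge0 // ler_pM2r ?invr_gt0.
Qed.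

Lemma size_biased_hit_prob_estimate n k :
  (\sum_(j < m) x j)%N = n -> (0 < k)%N -> (k ^ 2 <= m)%N ->
  `|size_biased_hit_prob R x k - m%:R / n%:R| <=
  r * M' / d / (r - 1) / r ^+ k + K2 / d ^+ 2 * (k%:R / rho ^+ k) / m%:R +
  4 * (k%:R ^+ 4 / m%:R ^+ 2).
Proof.
move=> xn k0 km.
have kK : (0 < k < k.+3)%N by rewrite k0 /=; lia.
have h1 := size_biased_hit_prob_expansion R x_gt0 kK km xn.
have h2 := delay_sum_estimate k; have h3 := size_biased_second_order_estimate k.
have m0 : 0 < m%:R :> R by rewrite ltr0n.
have mn0 : 0 <= m%:R / n%:R :> R by rewrite divr_ge0.
have mn1 : m%:R / n%:R <= 1 :> R.
  have -> : m%:R / n%:R = mu^-1 by rewrite (freq_gf_deriv1 xn) invf_div.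
  by rewrite invf_le1 // (lt_le_trans ltr01).
move: h1 h2 h3; set p := size_biased_hit_prob R x k.
set A := (polyseq (_ * _))`_k; set B := (polyseq (_ * _))`_k.
set q := m%:R / n%:R in mn0 mn1 * => h1 h2 h3.
have -> : p - q = q * (A - 1) + q * (k%:R / 2 * B / m%:R) +
   (p - q * (A + k%:R / 2 * B / m%:R)) by ring.
rewrite (le_trans (ler_normD _ _)) // lerD // (le_trans (ler_normD _ _)) // lerD //.
  by rewrite normrM ger0_norm // (le_trans (ler_piMl _ mn1)).
rewrite normrM ger0_norm // (le_trans (ler_piMl _ mn1)) //.
rewrite normrM (ger0_norm (_ : 0 <= m%:R^-1)) ?invr_ge0 // ler_pM2r ?invr_gt0 //.
rewrite normrM (ger0_norm (_ : 0 <= k%:R / 2)) ?divr_ge0 //.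
apply: (@le_trans _ _ (k%:R * (K2 / d ^+ 2 / rho ^+ k))); last first.
  by rewrite [leRHS]mulrCA mulrA -mulrA lexx.
rewrite ler_pM ?divr_ge0 // ler_pdivrMr // ler_peMr //.
by rewrite ler1n.
Qed.

End HittingEstimates.

(** * The limit on the closed disc *)

Local Open Scope classical_set_scope.
Local Open Scope complex_scope.



Section PowerSeriesOnDisc.
Variable R : realType.
Local Notation C := R[i].
Variables (a : nat -> C) (r : R).
Hypothesis a_cvg : forall z : C, `|z| <= r%:C -> cpseries_abs_cvg a z.
Hypothesis r_ge0 : 0 <= r.

(** Absolute convergence at r is convergence in R[i]; only the resulting
    Cauchy criterion for the real majorant is used. *)
Lemma majorant_cauchy (eps : R) : 0 < eps -> exists L, forall n p, (L <= n <= p)%N ->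
  \sum_(n <= l < p) normc (a l) * r ^+ l <= eps.
Proof.
move=> e0; have rr : `|r%:C| <= r%:C by rewrite normC_normc normc_real ger0_norm.
have /cvg_ex[l /cvgrPdist_lt/(_ (eps / 2)%:C)] := a_cvg rr.
rewrite ltcR divr_gt0 // => /(_ isT) [L _ LP]; exists L => n p /andP[Ln np].
have S q : [normed cpseries a r%:C] q = (\sum_(0 <= l < q) normc (a l) * r ^+ l)%:C.
  rewrite /cpseries /normed_series_of /series /= rmorph_sum; apply: eq_bigr => i _.
  by rewrite normC_normc normcM normcX normc_real ger0_norm.
have LP' q : (L <= q)%N -> normc (l - (\sum_(0 <= l < q) normc (a l) * r ^+ l)%:C) < eps / 2.
  move=> Lq; rewrite -ltcR -S -normC_normc; exact: LP.
have := LP' n Ln; have := LP' p (leq_trans Ln np).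
have -> : \sum_(n <= l0 < p) normc (a l0) * r ^+ l0 =
    (\sum_(0 <= l < p) normc (a l) * r ^+ l) - (\sum_(0 <= l < n) normc (a l) * r ^+ l).
  by rewrite [X in _ = X - _](big_cat_nat _ np) //= addrAC subrr add0r.
set A := \sum_(0 <= l < p) _; set B := \sum_(0 <= l < n) _ => h1 h2.
rewrite (le_trans (ler_norm _)) // -normc_real.
have -> : (A - B)%:C = (l - B%:C) - (l - A%:C) by rewrite rmorphB /=; ring.
by rewrite (le_trans (le_normcD _ _)) // normcN (splitr eps) lerD // ltW.
Qed.

(** The real and imaginary parts of the series converge by completeness of R,
    and hence so does the series in R[i]; the error of the partial sums is
    controlled by the tail of the majorant, uniformly on the closed disc. *)
Lemma cpsum_approx (eps : R) : 0 < eps -> exists L, forall z, normc z <= r ->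
  normc (cpsum a z - \sum_(0 <= l < L) a l * z ^+ l) <= eps.
Proof.
move=> e0; have [L LP] := majorant_cauchy e0.
have term z l : normc z <= r -> normc (a l * z ^+ l) <= normc (a l) * r ^+ l.
  move=> zr; rewrite normcM normcX ler_wpM2l ?normc_ge0 //.
  by rewrite lerXn2r ?nnegrE ?normc_ge0.
have part z n p : normc z <= r -> (n <= p)%N ->
    normc (\sum_(n <= l < p) a l * z ^+ l) <= \sum_(n <= l < p) normc (a l) * r ^+ l.
  by move=> zr np; rewrite (le_trans (normc_sum _ _ _)) // ler_sum // => l _; apply: term.
have cv (phi : C -> R) z : normc z <= r -> {morph phi : u v / u + v} -> phi 0 = 0 ->
    (forall u, `|phi u| <= normc u) -> cvgn (series (fun l => phi (a l * z ^+ l))).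
  move=> zr phiD phi0 phin; apply/cauchy_cvgP/cauchy_seriesP => e e1.
  have [|L1 L1P] := @majorant_cauchy (e / 2); first by rewrite divr_gt0.
  exists ([set n | (L1 <= n)%N], [set n | (L1 <= n)%N]); first by split; exists L1.
  move=> [n p] /= [Ln Lp]; rewrite -(big_morph phi phiD phi0).
  have [np|pn] := leqP n p; last by rewrite big_geq ?phi0 ?normr0 // ltnW.
  rewrite (le_lt_trans (phin _)) // (le_lt_trans (part z n p zr np)) //.
  rewrite (le_lt_trans (L1P n p _)) ?Ln //; lra.
have ReD : {morph @complex.Re R : u v / u + v} by case=> ? ? [].
have ImD : {morph @complex.Im R : u v / u + v} by case=> ? ? [].
have Re0 : complex.Re (0 : C) = 0 by [].
have Im0 : complex.Im (0 : C) = 0 by [].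
exists L => z zr.
have /cvg_ex[x xP] := cv _ z zr ReD erefl (@normc_Re_le R).
have /cvg_ex[y yP] := cv _ z zr ImD erefl (@normc_Im_le R).
have near_xy (e : R) : 0 < e -> exists N, forall n, (N <= n)%N ->
    normc (x +i* y - cpseries a z n) < e.
  move=> e1; have e2 : 0 < e / 2 by rewrite divr_gt0.
  have /cvgrPdist_lt/(_ _ e2)[N1 _ N1P] := xP; have /cvgrPdist_lt/(_ _ e2)[N2 _ N2P] := yP.
  exists (maxn N1 N2) => n; rewrite geq_max => /andP[/N1P h1 /N2P h2].
  rewrite (le_lt_trans (normc_le_ReIm _)) // (splitr e) ltrD //.
    by move: h1; rewrite /series /= -(big_morph _ ReD Re0) /cpseries /series /=; case: (\sum_(0 <= k < n) _).
  by move: h2; rewrite /series /= -(big_morph _ ImD Im0) /cpseries /series /=; case: (\sum_(0 <= k < n) _).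
pose K : numClosedFieldType := R[i].
have lim : (cpseries a z : K^nat) @ \oo --> (x +i* y : K).
  apply/cvgrPdist_lt => e; rewrite ltcE /= => /andP[/eqP Ime Ree].
  have eE : e = (complex.Re e)%:C by case: e Ime {Ree} => ? ? /= ->.
  have [N NP] := near_xy _ Ree; exists N => // n /= Nn.
  by rewrite eE normC_normc ltcR NP.
have -> : cpsum a z = x +i* y by apply/cvg_lim.
apply/ler_addgt0Pr => e e1; have [N NP] := near_xy _ e1.
set n := maxn N L.
pose S := \sum_(0 <= l < L) a l * z ^+ l.
rewrite -/S (_ : (x +i* y : C) - S = (cpseries a z n - S) + (x +i* y - cpseries a z n)); last by ring.
rewrite (le_trans (le_normcD _ _)) // lerD //.
  have -> : cpseries a z n - S = \sum_(L <= l < n) a l * z ^+ l.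
    rewrite /cpseries /series /S /= [X in X - _](@big_cat_nat _ _ _ L) //= ?leq_maxr //.
    by rewrite addrAC subrr add0r.
  by rewrite (le_trans (part _ _ _ zr _)) ?leq_maxr // LP // leqnn leq_maxr.
by rewrite ltW // NP // leq_maxl.
Qed.

Lemma cpsum_uniform_continuous (eps : R) : 0 < eps -> exists2 eta, 0 < eta &
  forall z z', normc z <= r -> normc z' <= r -> normc (z - z') <= eta ->
  normc (cpsum a z - cpsum a z') <= eps.
Proof.
move=> e0; have e3 : 0 < eps / 3 by rewrite divr_gt0.
have [L LP] := cpsum_approx e3.
have powB z z' l : normc z <= r -> normc z' <= r ->
    normc (z ^+ l - z' ^+ l) <= l%:R * r ^+ l.-1 * normc (z - z').
  move=> zr z'r; elim: l => [|l IHl]; first by rewrite subrr normc0 !mul0r.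
  have -> : z ^+ l.+1 - z' ^+ l.+1 = (z - z') * z ^+ l + z' * (z ^+ l - z' ^+ l).
    by rewrite !exprS; ring.
  rewrite (le_trans (le_normcD _ _)) // !normcM normcX /= -natr1.
  have h1 : normc (z - z') * normc z ^+ l <= normc (z - z') * r ^+ l.
    by rewrite ler_wpM2l ?normc_ge0 // lerXn2r ?nnegrE ?normc_ge0.
  have h2 : normc z' * normc (z ^+ l - z' ^+ l) <= l%:R * r ^+ l * normc (z - z').
    rewrite (le_trans (ler_pM (normc_ge0 _) (normc_ge0 _) z'r IHl)) //.
    case: (l) => [|l']; first by rewrite !mul0r mulr0.
    by rewrite /= exprS le_eqVlt; apply/orP; left; apply/eqP; ring.
  lra.
pose K := \sum_(0 <= l < L) normc (a l) * (l%:R * r ^+ l.-1) + 1.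
have K0 : 0 < K.
  rewrite ltr_wpDl // sumr_ge0 // => l _.
  by rewrite mulr_ge0 ?normc_ge0 // mulr_ge0 // exprn_ge0.
exists (eps / 3 / K); first by rewrite divr_gt0.
move=> z z' zr z'r zz'; pose P z := \sum_(0 <= l < L) a l * z ^+ l.
have h1 := LP z zr; have h2 := LP z' z'r.
have h3 : normc (P z - P z') <= eps / 3.
  rewrite /P -sumrB (le_trans (normc_sum _ _ _)) //.
  apply: (@le_trans _ _ (K * normc (z - z'))); last by rewrite mulrC -ler_pdivlMr.
  rewrite mulrDl mul1r mulr_suml ler_wpDr ?normc_ge0 // ler_sum // => l _.
  by rewrite -mulrBr normcM -mulrA ler_wpM2l ?normc_ge0 // powB.
rewrite (le_trans (normc_dist3 _ _ (P z) (P z'))) //.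
have third : eps = eps / 3 + eps / 3 + eps / 3 by field.
by rewrite [leRHS]third !lerD.
Qed.

(** Compactness: otherwise 1 - g takes arbitrarily small values at points of
    the disc that stay away from 1, and at a cluster point of such points g
    takes the value 1 by continuity. *)
Lemma one_sub_cpsum_lower_bound (delta : R) : 0 < delta ->
  (forall z : C, `|z| <= r%:C -> z != 1 -> cpsum a z != 1) ->
  exists2 c, 0 < c &
    forall z, normc z <= r -> delta <= normc (z - 1) -> c <= normc (1 - cpsum a z).
Proof.
move=> d0 a1; apply: contrapT => noc.
have bad (j : nat) : {z : C | [/\ normc z <= r, delta <= normc (z - 1) &
    normc (1 - cpsum a z) < j.+1%:R^-1]}.
  apply: cid; apply: contrapT => noz; apply: noc; exists j.+1%:R^-1 => // z zr dz.
  by rewrite leNgt; apply/negP => h; apply: noz; exists z.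
pose z_ j := sval (bad j).
have zP j : [/\ normc (z_ j) <= r, delta <= normc (z_ j - 1) &
    normc (1 - cpsum a (z_ j)) < j.+1%:R^-1] := svalP (bad j).
pose p_ j : R * R := (complex.Re (z_ j), complex.Im (z_ j)).
have sq : compact (`[- r, r]%classic `*` `[- r, r]%classic : set (R * R)).
  by apply: compact_setX; apply: segment_compact.
(* The disc is embedded in a square of R * R, which is compact. *)
have [|[x y] [_ clxy]] := sq (p_ @ \oo) _.
  exists 0 => // j _; have [zr _ _] := zP j.
  by split; rewrite /= in_itv /= -ler_norml (le_trans _ zr) ?normc_Re_le ?normc_Im_le.
pose w : C := x +i* y.
have close (eta : R) (N : nat) : 0 < eta ->
    exists2 j, (N <= j)%N & normc (w - z_ j) <= eta.
  move=> eta0; have eta2 : 0 < eta / 2 by rewrite divr_gt0.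
  have [||q [[j Nj <-] [/= bx by_]]] := clxy (p_ @` [set j | (N <= j)%N]) (ball (x, y) (eta / 2)).
  - by exists N => // j /= Nj; exists j.
  - exact: nbhsx_ballx.
  exists j => //; rewrite (le_trans (normc_le_ReIm _)) // (splitr eta) lerD // ltW //.
    by move: bx; rewrite /ball /=; case: (z_ j).
  by move: by_; rewrite /ball /=; case: (z_ j).
have wr : normc w <= r.
  apply/ler_addgt0Pr => e e0; have [j _ jw] := close e 0 e0.
  have [zr _ _] := zP j; rewrite -(subrK (z_ j) w) (le_trans (le_normcD _ _)) //.
  by rewrite addrC lerD.
have dw : delta <= normc (w - 1).
  apply/ler_addgt0Pr => e e0; have [j _ jw] := close e 0 e0.
  have [_ dz _] := zP j; rewrite (le_trans dz) //.
  have -> : z_ j - 1 = (w - 1) - (w - z_ j) by ring.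
  by rewrite (le_trans (le_normcD _ _)) // normcN lerD.
have w1 : w != 1 by rewrite -subr_eq0 -normc_gt0 (lt_le_trans d0).
have : normc (1 - cpsum a w) <= 0.
  apply/ler_addgt0Pr => e e0; rewrite add0r.
  have e2 : 0 < e / 2 by rewrite divr_gt0.
  have [eta eta0 etaP] := cpsum_uniform_continuous e2.
  have [j Nj jw] := close eta (Num.bound (e / 2)^-1) eta0.
  have [zr _ hz] := zP j.
  rewrite (le_trans (normc_dist2 1 (cpsum a w) (cpsum a (z_ j)))) //.
  rewrite (splitr e) lerD //; last exact: etaP.
  rewrite (le_trans (ltW hz)) // invf_ple ?posrE //.
  have := archi_boundP (_ : 0 <= (e / 2)^-1); rewrite invr_ge0 ltW // => /(_ isT) h.
  by rewrite (le_trans (ltW h)) // ler_nat leqW.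
rewrite leNgt normc_gt0 subr_eq0 eq_sym a1 //.
by rewrite normC_normc lecR.
Qed.

End PowerSeriesOnDisc.

(** * Estimates uniform in the multiset *)

Section UniformEstimate.
Variable R : realType.
Local Notation C := R[i].
Local Notation toC := (map_poly (real_complex R)).

Lemma pgf_freq_gf m' (x : 'I_m'.+1 -> nat) : pgf R x = toC (freq_gf R x 1).
Proof.
apply/polyP => l; rewrite coef_map coef_poly /= coefZ coef_sum.
have -> : \sum_(j < m'.+1) ('X^(1 * x j) : {poly R})`_l = #|[pred j | x j == l]|%:R.
  rewrite -sum1_card natr_sum [RHS]big_mkcond /=; apply: eq_bigr => j _.
  by rewrite mul1n coefXn inE eq_sym; case: eqP.
case: ltnP => [_|ln]; first by rewrite /rel_freq mulrC.
rewrite [#|_|]eq_card0 ?mulr0 // => j; rewrite !inE ltn_eqF // (leq_trans _ ln) // ltnS.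
by rewrite (bigD1 j) //= leq_addr.
Qed.

(** The correction is p^2 - p + V p^3 with p = 1 / mu. As mu >= 1 and alpha is
    within 1/2 of mu, p and 1 / alpha are bounded by 1 and 2, so this polynomial
    in p and V has an explicit Lipschitz constant. *)
Lemma correction_lipschitz (mu V : R) (alpha beta : C) (w : R) :
  1 <= mu -> w <= 2^-1 -> normc (mu%:C - alpha) <= w -> normc (V%:C - beta) <= w ->
  normc ((mu%:C - mu%:C ^+ 2 + V%:C) / mu%:C ^+ 3 -
         (alpha - alpha ^+ 2 + beta) / alpha ^+ 3) <= (9 + 14 * normc beta) * w.
Proof.
move=> mu1 w2 ma Vb; set p := (mu%:C)^-1; set q := alpha^-1.
have mu0 : mu%:C != 0 by rewrite -normc_gt0 normc_real; rewrite normr_gt0 gt_eqF //; lra.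
have na : 2^-1 <= normc alpha.
  have := le_normcB mu%:C alpha; have : mu <= normc mu%:C by rewrite normc_real ler_norm.
  by lra.
have a0 : alpha != 0 by rewrite -normc_gt0; lra.
have np : normc p <= 1.
  by rewrite normcV normc_real ger0_norm ?invf_le1 //; lra.
have nq : normc q <= 2.
  by rewrite normcV invf_ple ?posrE //; lra.
have p0 := normc_ge0 p; have q0 := normc_ge0 q; have b0 := normc_ge0 beta.
have w0 : 0 <= w := le_trans (normc_ge0 _) ma.
have pq : normc (p - q) <= 2 * w.
  have -> : p - q = - (mu%:C - alpha) * (p * q).
    by rewrite /p /q; field; rewrite mu0 a0.
  rewrite normcM normcN normcM mulrC ler_pM ?mulr_ge0 ?normc_ge0 //.
  by rewrite -[2]mul1r ler_pM.
have -> : (mu%:C - mu%:C ^+ 2 + V%:C) / mu%:C ^+ 3 -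
         (alpha - alpha ^+ 2 + beta) / alpha ^+ 3 =
   ((p - q) * (p + q - 1) + (V%:C - beta) * p ^+ 3) +
    beta * ((p - q) * (p ^+ 2 + p * q + q ^+ 2)).
  by rewrite /p /q; field; rewrite mu0 a0.
have t1 : normc ((p - q) * (p + q - 1)) <= 8 * w.
  rewrite normcM (_ : 8 * w = 2 * w * 4); last by ring.
  rewrite ler_pM ?normc_ge0 // (le_trans (le_normcD _ _)) // normcN normc1.
  by have := le_normcD p q; lra.
have t2 : normc ((V%:C - beta) * p ^+ 3) <= w.
  rewrite normcM -[leRHS]mulr1 ler_pM ?normc_ge0 // normcX.
  by rewrite exprn_ile1.
have t3 : normc (beta * ((p - q) * (p ^+ 2 + p * q + q ^+ 2))) <= normc beta * (14 * w).
  rewrite normcM ler_wpM2l // normcM (_ : 14 * w = 2 * w * 7); last by ring.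
  rewrite ler_pM ?normc_ge0 //.
  have h1 : normc (p ^+ 2) <= 1 by rewrite normcX exprn_ile1.
  have h2 : normc (p * q) <= 2 by rewrite normcM -[2]mul1r ler_pM.
  have h3 : normc (q ^+ 2) <= 4.
    by rewrite normcX (_ : 4 = 2 ^+ 2) ?lerXn2r ?nnegrE //; ring.
  have := le_normcD (p ^+ 2 + p * q) (q ^+ 2); have := le_normcD (p ^+ 2) (p * q).
  by lra.
rewrite (le_trans (le_normcD _ _)) //.
rewrite (le_trans (lerD (le_trans (le_normcD _ _) (lerD t1 t2)) t3)) //.
by move: (normc beta) => b; lra.
Qed.

(** Once w is small, closeness to g on the disc turns into the bounds M, M'
    and d required of the generating function, with values that depend only on
    g, g' and r. The functions g, g' and g'' are arbitrary here: of the limit only the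
    gap between g and 1 matters. *)
Lemma uniform_estimate (g g' g'' : C -> C) (r : R) : 1 < r ->
  (forall delta, 0 < delta -> exists2 c, 0 < c &
     forall z, normc z <= r -> delta <= normc (z - 1) -> c <= normc (1 - g z)) ->
  exists w0 B : R, [/\ 0 < w0, 0 < B &
  forall m' (x : 'I_m'.+1 -> nat) n k (w : R) (f := pgf R x) (m := m'.+1),
    (forall j, (0 < x j)%N) -> (\sum_(j < m) x j)%N = n -> (0 < k)%N -> (k ^ 2 <= m)%N ->
    w <= w0 ->
    (forall z : C, `|z| <= r%:C -> `|f.[z] - g z| + `|f^`().[z] - g' z| < w%:C) ->
    (`|f^`(2).[1] - g'' 1| < w%:C ->
      normc ((hit_prob R x k)%:C - m%:R / n%:R
         + (g' 1 - g' 1 ^+ 2 + g'' 1) / (g' 1 ^+ 3 * m%:R)) <=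
      B * ((Num.sqrt r ^+ k)^-1 + w) / m%:R +
      B * ((r ^+ k)^-1 + k%:R ^+ 4 / m%:R ^+ 2)) /\
    `|size_biased_hit_prob R x k - m%:R / n%:R| <=
      B * (k%:R / Num.sqrt r ^+ k) / m%:R +
      B * ((r ^+ k)^-1 + k%:R ^+ 4 / m%:R ^+ 2)].
Proof.
move=> r1 gap; have r0 : 0 < r := lt_trans ltr01 r1.
pose M := normc (g r%:C) + 1; pose M' := normc (g' r%:C) + 1.
have M1 : 1 <= M by rewrite lerDr normc_ge0.
have M'1 : 1 <= M' by rewrite lerDr normc_ge0.
have M0 : 0 < M by lra.
pose rho := Num.sqrt r; pose h := rho - 1.
have rho1 : 1 < rho by rewrite -sqrtr1 ltr_sqrt.
have h0 : 0 < h by rewrite subr_gt0.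
pose delta := Num.min h (h ^+ 2 / (2 * M)).
have delta0 : 0 < delta by rewrite lt_min h0 divr_gt0 ?exprn_gt0 // mulr_gt0.
have [c0 c00 c0P] := gap _ delta0.
pose c := c0 / 2; have cgt0 : 0 < c by rewrite divr_gt0.
pose d := Num.min 2^-1 (c / (r + 1)).
have d0 : 0 < d by rewrite lt_min invr_gt0 ltr0n divr_gt0 // addr_gt0.
pose K2 := (M ^+ 2 + M) / (rho - 1) ^+ 2.
have K20 : 0 <= K2 by rewrite divr_ge0 ?sqr_ge0 // addr_ge0 ?sqr_ge0 // ltW.
pose CA := d^-1 / (r - 1); pose CB := K2 / d ^+ 3 / (rho - 1).
pose CC := r * M' / d / (r - 1); pose CD := K2 / d ^+ 2.
pose CE := 9 + 14 * normc (g'' 1).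
have dge0 := ltW d0; have rho_ge0 : 0 <= rho - 1 := ltW h0.
have rge0 : 0 <= r - 1 by lra.
have CA0 : 0 <= CA by rewrite divr_ge0 // invr_ge0.
have CB0 : 0 <= CB by apply: divr_ge0 => //; apply: divr_ge0 => //; apply: exprn_ge0.
have CC0 : 0 <= CC.
  by do 2!apply: divr_ge0 => //; apply: mulr_ge0; lra.
have CD0 : 0 <= CD by apply: divr_ge0 => //; apply: exprn_ge0.
have CE0 : 0 <= CE by rewrite addr_ge0 // mulr_ge0 // normc_ge0.
exists (Num.min 2^-1 c), (CA + CB + CC + CD + CE + 4); split.
- by rewrite lt_min invr_gt0 ltr0n.
- lra.
set B := CA + CB + CC + CD + CE + 4.
have CAB : CA <= B by rewrite /B; lra.
have CBB : CB <= B by rewrite /B; lra.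
have CCB : CC <= B by rewrite /B; lra.
have CDB : CD <= B by rewrite /B; lra.
have CEB : CE <= B by rewrite /B; lra.
have B4 : 4 <= B by rewrite /B; lra.
clearbody B; clear CA0 CB0 CC0 CD0 CE0.
move=> m' x n k w f m x0 xn k0 km; rewrite le_min => /andP[w2 wc] fg.
pose F := freq_gf R x 1; have fF : f = toC F := pgf_freq_gf x.
have Fn := freq_gf_nneg R x 1; have F0 := freq_gf_coef_small R x0 (ltn0Sn 0).
have F1 : F.[1] = 1 := freq_gf_horner1 R x 1.
have fg0 z : normc z <= r -> normc (f.[z] - g z) < w /\ normc (f^`().[z] - g' z) < w.
  move=> zr; have := fg z; rewrite !normC_normc lecR -rmorphD ltcR => /(_ zr) h1.
  have := normc_ge0 (f.[z] - g z); have := normc_ge0 (f^`().[z] - g' z).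
  move=> {fg}; move: (normc _) (normc _) h1 => u v h1 u0 v0.
  by split; [apply: le_lt_trans h1; rewrite lerDl | apply: le_lt_trans h1; rewrite lerDr].
have nr : normc r%:C <= r by rewrite normc_real ger0_norm // ltW.
have close_le (y : R) (u : C) : normc (y%:C - u) < w -> y <= normc u + 1.
  move=> yu; have := le_normcB y%:C u; have : y <= normc y%:C by rewrite normc_real ler_norm.
  lra.
have FM : F.[r] <= M.
  by apply: close_le; have [] := fg0 r%:C nr; rewrite fF toC_horner.
have FM' : F^`().[r] <= M'.
  by apply: close_le; have [_] := fg0 r%:C nr; rewrite fF deriv_map toC_horner.
have [T [TE T1]] := pgf_quotient F1.
have dT z : normc z <= r -> d <= normc (toC T).[z].
  apply: (pgf_quotient_lower_bound Fn F0 F1 r1 FM M0 cgt0 TE (delta := delta)).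
  - by rewrite ge_min lexx.
  - by rewrite ge_min lexx orbT.
  move=> {}z zr dz; rewrite -fF.
  have := c0P z zr dz; have [fgz _] := fg0 z zr.
  have := normc_dist2 1 (g z) f.[z]; rewrite (normc_distC (g z)) -/g /c in wc *; lra.
have mu1 := pgf_mean_ge1 Fn F0 F1; set mu := F^`().[1] in mu1.
have n1 : normc 1 <= r by rewrite normc1 ltW.
have [_ muw] := fg0 1 n1; rewrite fF deriv_map toC_horner1 -/mu in muw.
have e1 : 0 <= (r ^+ k)^-1 by rewrite invr_ge0 exprn_ge0 // ltW.
have e2 : 0 <= (rho ^+ k)^-1 by rewrite invr_ge0 exprn_ge0 // sqrtr_ge0.
have mge0 : 0 <= (m%:R)^-1 :> R by rewrite invr_ge0.
have e3 : 0 <= k%:R ^+ 4 / m%:R ^+ 2 :> R by rewrite divr_ge0 // exprn_ge0.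
have w00 : 0 <= w by rewrite (le_trans (normc_ge0 _) (ltW muw)).
split=> [|]; last first.
  have := size_biased_hit_prob_estimate x0 r1 FM FM' d0 TE dT xn k0 km.
  move=> /le_trans; apply.
  have y0 : 0 <= k%:R / rho ^+ k by rewrite divr_ge0 // exprn_ge0 // sqrtr_ge0.
  have h1 : CD * (k%:R / rho ^+ k) / m%:R <= B * (k%:R / rho ^+ k) / m%:R.
    by rewrite ler_wpM2r // ler_wpM2r.
  have h2 : CC / r ^+ k <= B / r ^+ k by rewrite ler_wpM2r.
  have h3 : 4 * (k%:R ^+ 4 / m%:R ^+ 2) <= B * (k%:R ^+ 4 / m%:R ^+ 2).
    by rewrite ler_wpM2r.
  rewrite [X in _ <= _ + X]mulrDr [leRHS]addrA; apply: lerD h3.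
  by rewrite [leLHS]addrC; apply: lerD.
move=> f2; set V := F^`(2).[1].
have Vw : normc (V%:C - g'' 1) < w.
  by rewrite -toC_horner1 -derivn_map -fF -ltcR -normC_normc.
have lip := correction_lipschitz mu1 w2 (ltW muw) (ltW Vw).
have est := hit_prob_estimate x0 r1 FM FM' d0 TE dT xn k0 km.
set X := hit_prob R x k - _ + _ in est.
have mC : m%:R != 0 :> C by rewrite pnatr_eq0.
set D := _ - _ in lip.
have -> : (hit_prob R x k)%:C - m%:R / n%:R + (g' 1 - g' 1 ^+ 2 + g'' 1) / (g' 1 ^+ 3 * m%:R) =
    X%:C - D / m%:R.
  have -> : X%:C = (hit_prob R x k)%:C - m%:R / n%:R +
      (mu%:C - mu%:C ^+ 2 + V%:C) / mu%:C ^+ 3 / m%:R.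
    rewrite /X rmorphD rmorphB /= !rmorphM !fmorphV rmorphM !rmorphD rmorphN /=.
    by rewrite !rmorphXn !rmorph_nat invfM mulrA.
  by rewrite /D invfM mulrA; ring.
rewrite (le_trans (le_normcD _ _)) // normcN normcM normcV normc_nat normc_real.
have h1 : CB / rho ^+ k / m%:R <= B * (rho ^+ k)^-1 / m%:R.
  by rewrite ler_wpM2r // ler_wpM2r.
have h2 : CA / r ^+ k <= B / r ^+ k by rewrite ler_wpM2r.
have h3 : 4 * (k%:R ^+ 4 / m%:R ^+ 2) <= B * (k%:R ^+ 4 / m%:R ^+ 2).
  by rewrite ler_wpM2r.
have h4 : normc D / m%:R <= B * w / m%:R.
  by rewrite ler_wpM2r // (le_trans lip) // ler_wpM2r.
have -> : B * ((rho ^+ k)^-1 + w) / m%:R + B * ((r ^+ k)^-1 + k%:R ^+ 4 / m%:R ^+ 2) =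
  B / r ^+ k + B * (rho ^+ k)^-1 / m%:R + B * (k%:R ^+ 4 / m%:R ^+ 2) + B * w / m%:R.
  by ring.
apply: lerD h4; apply: le_trans est _.
by apply: lerD h3; apply: lerD h1.
Qed.

End UniformEstimate.

(** * Asymptotics and the theorem *)

Section Asymptotics.
Variable R : realType.

Lemma card_ratio (T : finType) (A B : {pred T}) : {subset A <= B} ->
  0 <= (#|A|%:R / #|B|%:R : R) <= 1.
Proof.
move=> AB; rewrite divr_ge0 //=; have [B0|B0] := posnP #|B|.
  by rewrite B0 invr0 mulr0.
by rewrite ler_pdivrMr ?ltr0n // mul1r ler_nat subset_leq_card //; apply/fintype.subsetP.
Qed.

Lemma hit_prob_ge0_le1 m (x : 'I_m -> nat) k : 0 <= hit_prob R x k <= 1.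
Proof. exact: card_ratio. Qed.

Lemma size_biased_hit_prob_ge0_le1 m (x : 'I_m -> nat) k :
  0 <= size_biased_hit_prob R x k <= 1.
Proof.
have ratio j : 0 <= (#|[pred s : {perm 'I_m} | starts_at j s & hits x k s]|%:R /
     #|[pred s : {perm 'I_m} | starts_at j s]|%:R : R) <= 1.
  by apply: card_ratio => s; rewrite !inE => /andP[].
apply/andP; split.
  by apply: sumr_ge0 => j _; rewrite mulr_ge0 ?divr_ge0 //; case/andP: (ratio j).
apply: (@le_trans _ _ (\sum_(j < m) (x j)%:R / (\sum_(i < m) x i)%N%:R)).
  by apply: ler_sum => j _; rewrite ler_piMr ?divr_ge0 //; case/andP: (ratio j).
rewrite -mulr_suml -natr_sum; set n := (\sum_(i < m) x i)%N.
have [->|n0] := posnP n; first by rewrite mul0r.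
by rewrite divff // pnatr_eq0 -lt0n.
Qed.

Lemma natr_div_expr_cvg0 (rho : R) (k : nat -> nat) : 1 < rho ->
  k n @[n --> \oo] --> \oo -> forall eps, 0 < eps ->
  \forall n \near \oo, (k n)%:R / rho ^+ k n <= eps.
Proof.
move=> rho1 koo eps e0; have [c c0 cP] := expr_ge_sqr rho1.
have /cvgnyPge/(_ (Num.bound (c * eps)^-1).+1) := koo.
apply: filterS => n kn.
have k0 : 0 < (k n)%:R :> R by rewrite ltr0n (leq_trans _ kn).
rewrite ler_pdivrMr ?exprn_gt0 ?(lt_trans ltr01) //.
apply: (@le_trans _ _ (eps * (c * (k n)%:R ^+ 2))); last by rewrite ler_pM2l.
rewrite expr2 !mulrA ler_peMl ?(ltW k0) // (mulrC eps).
rewrite -ler_pdivrMl ?mulr_gt0 // mulr1.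
have := archi_boundP (_ : 0 <= (c * eps)^-1).
rewrite invr_ge0 mulr_ge0 ?(ltW c0) ?(ltW e0) // => /(_ isT) /ltW h.
by rewrite (le_trans h) // ler_nat (leq_trans _ kn).
Qed.

Lemma littleo_of_ratio (u v : nat -> R) (m : nat -> nat) :
  (\forall n \near \oo, u n = v n / (m n)%:R) ->
  (forall eps, 0 < eps -> \forall n \near \oo, `|v n| <= eps) ->
  u =o_\oo (fun n => (m n)%:R^-1 : R).
Proof.
move=> uv v0; apply/eqoP => eps e0; near=> n.
have -> : u n = v n / (m n)%:R by near: n.
rewrite normrM; apply: ler_wpM2r => //; near: n; exact: v0.
Unshelve. all: by end_near. Qed.

End Asymptotics.

Theorem theorem3 (R : realType) (m k : nat -> nat)
    (m_gt0 : forall n, (0 < m n)%N) (k_gt0 : forall n, (0 < k n)%N)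
    (k_oo : k n @[n --> \oo] --> \oo)
    (k_small : (fun n => (k n)%:R : R) =o_\oo (fun n => Num.sqrt (m n)%:R : R))
    (r : R) (r_gt1 : 1 < r)
    (a : nat -> R[i])
    (g : R[i] -> R[i] := cpsum a)
    (g' : R[i] -> R[i] := cpsum (cpseries_diffs a))
    (g'' : R[i] -> R[i] := cpsum (cpseries_diffs (cpseries_diffs a)))
    (g_abs_cvg : forall z : R[i], `|z| <= r%:C -> cpseries_abs_cvg a z)
    (g_neq1 : forall z : R[i], `|z| <= r%:C -> z != 1 -> g z != 1)
    (w : nat -> R) (w_o1 : w =o_\oo (fun=> 1 : R))
    (eps' : R) (eps'_gt0 : 0 < eps') (eps'_lt : eps' < r) :
  exists q1 q2 : nat -> R,
    [/\ is_oDO q1 (fun n => (m n)%:R^-1)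
          (fun n => r ^- k n + (k n)%:R ^+ 4 / (m n)%:R ^+ 2),
        is_oDO q2 (fun n => (m n)%:R^-1)
          (fun n => (r - eps') ^- k n + (k n)%:R ^+ 4 / (m n)%:R ^+ 2) &
        forall (n : nat) (x : 'I_(m n) -> nat) (f := pgf R x),
          (forall j, (0 < x j)%N) ->
          (\sum_(j < m n) x j)%N = n ->
          (forall z : R[i], `|z| <= r%:C ->
             `|f.[z] - g z| + `|f^`().[z] - g' z| < (w n)%:C) ->
          (`|f^`(2).[1] - g'' 1| < (w n)%:C ->
             `|(hit_prob R x (k n))%:C - (m n)%:R / n%:R
               + (g' 1 - g' 1 ^+ 2 + g'' 1) / (g' 1 ^+ 3 * (m n)%:R)|
             <= (q1 n)%:C) /\
          `|size_biased_hit_prob R x (k n) - (m n)%:R / n%:R| <= q2 n].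
Proof.
have r_gt0 : 0 < r := lt_trans ltr01 r_gt1.
have rho1 : 1 < Num.sqrt r by rewrite -sqrtr1 ltr_sqrt.
have gap delta : 0 < delta -> exists2 c, 0 < c &
    forall z, normc z <= r -> delta <= normc (z - 1) -> c <= normc (1 - g z).
  by move=> d0; apply: one_sub_cpsum_lower_bound g_neq1 => //; exact: ltW.
have [w0 [B [w00 B0 est]]] := uniform_estimate g' g'' r_gt1 gap.
pose good n := ((k n) ^ 2 <= m n)%N && (w n <= w0).
have w_small e : 0 < e -> \forall n \near \oo, `|w n| <= e.
  by move=> e0; move/eqoP: w_o1 => /(_ e e0); apply: filterS => n; rewrite normr1 mulr1.
have near_good : \forall n \near \oo, good n.
  near=> n; apply/andP; split; last first.
    by rewrite (le_trans (ler_norm _)) //; near: n; apply: w_small.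
  have : `|(k n)%:R : R| <= 1 * `|Num.sqrt (m n)%:R : R|.
    by near: n; move/eqoP: k_small => /(_ 1 ltr01).
  rewrite mul1r normr_nat ger0_norm ?sqrtr_ge0 // => h.
  have : ((k n)%:R : R) ^+ 2 <= Num.sqrt (m n)%:R ^+ 2.
    by rewrite lerXn2r ?nnegrE ?sqrtr_ge0.
  by rewrite sqr_sqrtr // -natrX ler_nat.
pose gamma n := (g' 1 - g' 1 ^+ 2 + g'' 1) / (g' 1 ^+ 3 * (m n)%:R).
(* Only finitely many n are not good. For these the bound must still hold for
   every x, and it does because hitting probabilities are at most 1. *)
pose u1 n := if good n then B * ((Num.sqrt r ^+ k n)^-1 + `|w n|) / (m n)%:R
             else 1 + (m n)%:R / n%:R + normc (gamma n).
pose u2 n := if good n then B * ((k n)%:R / Num.sqrt r ^+ k n) / (m n)%:R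
             else 1 + (m n)%:R / n%:R.
pose v1 n := B * (r ^- k n + (k n)%:R ^+ 4 / (m n)%:R ^+ 2).
pose v2 n := B * ((r - eps') ^- k n + (k n)%:R ^+ 4 / (m n)%:R ^+ 2).
have k4_ge0 n : 0 <= (k n)%:R ^+ 4 / (m n)%:R ^+ 2 :> R by rewrite divr_ge0 // exprn_ge0.
have v1_ge0 n : 0 <= v1 n.
  by rewrite mulr_ge0 ?(ltW B0) // addr_ge0 // invr_ge0 exprn_ge0 // ltW.
have reps : 0 < r - eps' by rewrite subr_gt0.
have v12 n : v1 n <= v2 n.
  rewrite ler_pM2l // lerD2r lef_pV2 ?posrE ?exprn_gt0 //.
  by rewrite lerXn2r ?nnegrE ?(ltW reps) ?(ltW r_gt0) // gerBl ltW.
exists (fun n => u1 n + v1 n), (fun n => u2 n + v2 n); split.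
- exists u1, v1; split=> //.
    apply: (@littleo_of_ratio _ _ (fun n => B * ((Num.sqrt r ^+ k n)^-1 + `|w n|))).
      by apply: filterS near_good => n gn; rewrite /u1 gn.
    move=> e e0; have eB : 0 < e / B / 2 by rewrite !divr_gt0.
    near=> n; have s0 : 0 <= (Num.sqrt r ^+ k n)^-1 by rewrite invr_ge0 exprn_ge0 ?sqrtr_ge0.
    rewrite ger0_norm; last by rewrite mulr_ge0 ?addr_ge0 ?(ltW B0).
    rewrite mulrC -ler_pdivlMr // [leRHS]splitr lerD //; last by near: n; exact: w_small.
    apply: (@le_trans _ _ ((k n)%:R / Num.sqrt r ^+ k n)).
      by rewrite ler_peMl // ler1n.
    by near: n; exact: natr_div_expr_cvg0.
  apply/eqO_exP; exists B => //; near=> n.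
  by rewrite normrM (gtr0_norm B0).
- exists u2, v2; split=> //.
    apply: (@littleo_of_ratio _ _ (fun n => B * ((k n)%:R / Num.sqrt r ^+ k n))).
      by apply: filterS near_good => n gn; rewrite /u2 gn.
    move=> e e0; have eB : 0 < e / B by rewrite divr_gt0.
    near=> n; rewrite ger0_norm; last first.
      by rewrite mulr_ge0 ?(ltW B0) // divr_ge0 // exprn_ge0 // sqrtr_ge0.
    by rewrite mulrC -ler_pdivlMr //; near: n; exact: natr_div_expr_cvg0.
  apply/eqO_exP; exists B => //; near=> n.
  by rewrite normrM (gtr0_norm B0).
move=> n x f x0 xn fg.
have P01 := hit_prob_ge0_le1 R x (k n); have Q01 := size_biased_hit_prob_ge0_le1 R x (k n).
have mn0 : 0 <= (m n)%:R / n%:R :> R by rewrite divr_ge0.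
have mnC : (m n)%:R / n%:R = ((m n)%:R / n%:R)%:C :> R[i].
  by rewrite rmorphM fmorphV /= !rmorph_nat.
rewrite normC_normc lecR.
have [gn|badn] := boolP (good n); last first.
  rewrite /u1 /u2 (negPf badn); split=> [_|].
    rewrite (le_trans (le_normcD _ _)) // -[leLHS]addr0 -/(gamma n).
    rewrite addr0 addrAC lerD // mnC -rmorphB normc_real.
    rewrite (le_trans (ler_normB _ _)) // (ger0_norm mn0) (ger0_norm (andP P01).1).
    have := v1_ge0 n; case/andP: P01; lra.
  rewrite (le_trans (ler_normB _ _)) // (ger0_norm mn0) ger0_norm; last by case/andP: Q01.
  have := v1_ge0 n; have := v12 n; case/andP: Q01; lra.
have [km wn] := andP gn; rewrite /u1 /u2 gn.
have main : 
   (`|f^`(2).[1] - g'' 1| < (w n)%:C ->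
      normc ((hit_prob R x (k n))%:C - (m n)%:R / n%:R + gamma n) <=
      B * ((Num.sqrt r ^+ k n)^-1 + w n) / (m n)%:R + v1 n) /\
    `|size_biased_hit_prob R x (k n) - (m n)%:R / n%:R| <=
      B * ((k n)%:R / Num.sqrt r ^+ k n) / (m n)%:R + v1 n.
  have := m_gt0 n; rewrite /gamma /v1 {P01 Q01 mn0 mnC}; move: @f fg; move: x x0 xn km.
  case: (m n) => // m' x x0 xn km f fg _.
  exact: est x n (k n) (w n) x0 xn (k_gt0 n) km wn fg.
split=> [f2|].
  rewrite (le_trans (main.1 f2)) // lerD2r ler_wpM2r // ler_pM2l // lerD2l.
  exact: ler_norm.
by rewrite (le_trans main.2) // lerD2l.
Unshelve. all: by end_near. Qed.
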